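(* For every $A\in\mathcal L_\Box$: if $\mathsf{iGLH}\nvdash A$, then there is a substitution $\gamma$ such that $\mathsf{iGLH^\Box}\nvdash\gamma(A)$.
   Context: Formulas. The modal language $\mathcal L_\Box$ is built from countably many propositional variables $x_1,x_2,\dots$, countably many propositional parameters $p_1,p_2,\dots$ (variables and parameters together are called atoms), the constant $\bot$, the binary connectives $\wedge,\vee,\to$ and the unary modality $\Box$. Put $\neg A:=A\to\bot$, $\top:=\bot\to\bot$, $\boxdot A:=A\wedge\Box A$. Let $\mathsf{parb}$ be the set consisting of $\bot$, all parameters, and all formulas of the form $\Box B$; let $\mathsf{atomb}:=\mathsf{parb}\cup\{\text{variables}\}$. For a set $X$ of formulas, $\mathcal L_0(X)$ is the least set containing $X\cup\{\bot\}$ and closed under $\wedge,\vee,\to$; for a set $\Gamma$ of formulas, $\Gamma(X):=\Gamma\cap\mathcal L_0(X)$ and $\Gamma(\Box):=\Gamma(\mathsf{parb})$. Logics. $\mathsf{iK4}$ is the least set of $\mathcal L_\Box$-formulas closed under modus ponens that contains every instance of the axiom schemata of intuitionistic propositional logic $\mathsf{IPC}$, of $\Box(A\to B)\to(\Box A\to\Box B)$, of $\Box A\to\Box\Box A$, and of $p\to\Box p$ for every parameter $p$, together with $\Box\varphi$ for every such instance $\varphi$ (hence it is closed under necessitation). $\mathsf{iGL}$ is defined in the same way with, in addition, the Löb schema $\Box(\Box A\to A)\to\Box A$ (and its boxed instances). In general a logic $T$ is a set of formulas containing $\mathsf{IPC}$ and closed under modus ponens; $T\vdash A$ means $A\in T$.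 Substitutions. A substitution $\theta$ assigns a formula to each variable and is the identity on parameters; it is extended to all formulas by fixing $\bot$ and commuting with $\wedge,\vee,\to,\Box$. Its outer version $\hat\theta$ agrees with $\theta$ on atoms, fixes $\bot$, commutes with $\wedge,\vee,\to$, and satisfies $\hat\theta(\Box B)=\Box B$. Box translation. $x^\Box:=\boxdot x$ for variables $x$; $A^\Box:=A$ for $A\in\mathsf{parb}$; $(B\circ C)^\Box:=B^\Box\circ C^\Box$ for $\circ\in\{\wedge,\vee\}$; $(B\to C)^\Box:=\boxdot(B^\Box\to C^\Box)$. Let $\mathsf S:=\{B^\Box:B\in\mathcal L_\Box\}$, and for a logic $T$ let $\mathsf C^T:=\{A:T\vdash A\to\Box A\}$. NNIL. The classes $\mathsf{NI}$ and $\mathsf{NNIL}$ are the least sets of formulas such that every element of $\mathsf{atomb}$ belongs to both, both are closed under $\wedge$ and $\vee$, and $B\to C\in\mathsf{NNIL}$ whenever $B\in\mathsf{NI}$ and $C\in\mathsf{NNIL}$. Thus $\mathsf{NNIL}(\Box)=\mathsf{NNIL}\cap\mathcal L_0(\mathsf{parb})$. Projectivity. For a logic $T$ and $\Gamma\subseteq\mathcal L_0(\mathsf{parb})$, a formula $A$ is $\Gamma$-projective in $T$ if there are a substitution $\theta$ and $B\in\Gamma$ with $T\vdash\hat\theta(A)\leftrightarrow B$ and $T\vdash A\to(x\leftrightarrow\theta(x))$ for every variable $x$. ${\downarrow}^T\Gamma$ denotes the set of all $\Gamma$-projective formulas in $T$. Preservativity. For a logic $T$ and a set $\Gamma$ of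 formulas, $A\rhd^{\Gamma}_{T}B$ means: for every $E\in\Gamma$, $T\vdash E\to A$ implies $T\vdash E\to B$. The logic iGLH. Let $\Gamma_{\mathsf H}:=\mathsf C^{\mathsf{iGL}}\cap{\downarrow}^{\mathsf{iGL}}(\mathsf S\cap\mathsf{NNIL}(\Box))$. $\mathsf{iGLH}$ is the least set of formulas closed under modus ponens containing $\mathsf{iGL}$ and, for all $A,B$ with $A\rhd^{\Gamma_{\mathsf H}}_{\mathsf{iGL}}B$, the formulas $\Box A\to\Box B$ and $\Box(\Box A\to\Box B)$. The logic $\mathsf{iGLH^\Box}$ is the least set of formulas closed under modus ponens containing $\mathsf{iGL}$ and, for all $A,B$ with $A\rhd^{\mathsf S\cap\mathsf{NNIL}(\Box)}_{\mathsf{iGL}}B$, the formulas $\Box A\to\Box B$ and $\Box(\Box A\to\Box B)$. *)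

(* Defs.v *)
Inductive form : Type :=
| Var : nat -> form
| Par : nat -> form
| Bot : form
| And : form -> form -> form
| Or  : form -> form -> form
| Imp : form -> form -> form
| Box : form -> form.

Definition Neg (A : form) : form := Imp A Bot.
Definition Top : form := Imp Bot Bot.
Definition Boxdot (A : form) : form := And A (Box A).
Definition Iff (A B : form) : form := And (Imp A B) (Imp B A).

Definition parb (A : form) : Prop :=
  A = Bot \/ (exists p, A = Par p) \/ (exists B, A = Box B).
Definition atomb (A : form) : Prop := parb A \/ exists x, A = Var x.

Inductive L0 (X : form -> Prop) : form -> Prop :=
| L0_in  : forall A, X A -> L0 X A
| L0_bot : L0 X Bot
| L0_and : forall A B, L0 X A -> L0 X B -> L0 X (And A B)
| L0_or  : forall A B, L0 X A -> L0 X B -> L0 X (Or A B)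
| L0_imp : forall A B, L0 X A -> L0 X B -> L0 X (Imp A B).

Definition restr (G X : form -> Prop) (A : form) : Prop := G A /\ L0 X A.
Definition restrBox (G : form -> Prop) : form -> Prop := restr G parb.

Definition logic := form -> Prop.
Definition derives (T : logic) (A : form) : Prop := T A.

Inductive ax_IPC : form -> Prop :=
| ipc1 : forall A B, ax_IPC (Imp A (Imp B A))
| ipc2 : forall A B C, ax_IPC (Imp (Imp A (Imp B C)) (Imp (Imp A B) (Imp A C)))
| ipc3 : forall A B, ax_IPC (Imp (And A B) A)
| ipc4 : forall A B, ax_IPC (Imp (And A B) B)
| ipc5 : forall A B, ax_IPC (Imp A (Imp B (And A B)))
| ipc6 : forall A B, ax_IPC (Imp A (Or A B))
| ipc7 : forall A B, ax_IPC (Imp B (Or A B))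
| ipc8 : forall A B C, ax_IPC (Imp (Imp A C) (Imp (Imp B C) (Imp (Or A B) C)))
| ipc9 : forall A, ax_IPC (Imp Bot A).

Inductive ax_iK4 : form -> Prop :=
| k4_ipc : forall A, ax_IPC A -> ax_iK4 A
| k4_K   : forall A B, ax_iK4 (Imp (Box (Imp A B)) (Imp (Box A) (Box B)))
| k4_4   : forall A, ax_iK4 (Imp (Box A) (Box (Box A)))
| k4_par : forall p, ax_iK4 (Imp (Par p) (Box (Par p))).

Inductive ax_iGL : form -> Prop :=
| gl_k4  : forall A, ax_iK4 A -> ax_iGL A
| gl_lob : forall A, ax_iGL (Imp (Box (Imp (Box A) A)) (Box A)).

Inductive iK4 : logic :=
| iK4_ax  : forall A, ax_iK4 A -> iK4 A
| iK4_nec : forall A, ax_iK4 A -> iK4 (Box A)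
| iK4_mp  : forall A B, iK4 (Imp A B) -> iK4 A -> iK4 B.

Inductive iGL : logic :=
| iGL_ax  : forall A, ax_iGL A -> iGL A
| iGL_nec : forall A, ax_iGL A -> iGL (Box A)
| iGL_mp  : forall A B, iGL (Imp A B) -> iGL A -> iGL B.

Definition subst := nat -> form.

Fixpoint app_subst (th : subst) (A : form) : form :=
  match A with
  | Var x => th x
  | Par p => Par p
  | Bot => Bot
  | And B C => And (app_subst th B) (app_subst th C)
  | Or B C => Or (app_subst th B) (app_subst th C)
  | Imp B C => Imp (app_subst th B) (app_subst th C)
  | Box B => Box (app_subst th B)
  end.

Fixpoint app_osubst (th : subst) (A : form) : form :=
  match A with
  | Var x => th x
  | Par p => Par p
  | Bot => Bot
  | And B C => And (app_osubst th B) (app_osubst th C)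
  | Or B C => Or (app_osubst th B) (app_osubst th C)
  | Imp B C => Imp (app_osubst th B) (app_osubst th C)
  | Box B => Box B
  end.

Fixpoint boxtr (A : form) : form :=
  match A with
  | Var x => Boxdot (Var x)
  | Par p => Par p
  | Bot => Bot
  | Box B => Box B
  | And B C => And (boxtr B) (boxtr C)
  | Or B C => Or (boxtr B) (boxtr C)
  | Imp B C => Boxdot (Imp (boxtr B) (boxtr C))
  end.

Definition S_set (A : form) : Prop := exists B, A = boxtr B.

Definition C_set (T : logic) (A : form) : Prop := derives T (Imp A (Box A)).

Inductive NI : form -> Prop :=
| NI_at  : forall A, atomb A -> NI A
| NI_and : forall A B, NI A -> NI B -> NI (And A B)
| NI_or  : forall A B, NI A -> NI B -> NI (Or A B).

Inductive NNIL : form -> Prop :=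
| NNIL_at  : forall A, atomb A -> NNIL A
| NNIL_and : forall A B, NNIL A -> NNIL B -> NNIL (And A B)
| NNIL_or  : forall A B, NNIL A -> NNIL B -> NNIL (Or A B)
| NNIL_imp : forall A B, NI A -> NNIL B -> NNIL (Imp A B).

Definition inter (G H : form -> Prop) (A : form) : Prop := G A /\ H A.

Definition S_NNILbox : form -> Prop := inter S_set (restrBox NNIL).

Definition projective (T : logic) (G : form -> Prop) (A : form) : Prop :=
  exists (th : subst) (B : form),
    G B /\ derives T (Iff (app_osubst th A) B) /\
    forall x : nat, derives T (Imp A (Iff (Var x) (th x))).

Definition preserv (T : logic) (G : form -> Prop) (A B : form) : Prop :=
  forall E, G E -> derives T (Imp E A) -> derives T (Imp E B).

Definition Gamma_H : form -> Prop :=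
  inter (C_set iGL) (projective iGL S_NNILbox).

Inductive iGLH : logic :=
| iGLH_base : forall A, iGL A -> iGLH A
| iGLH_pres : forall A B, preserv iGL Gamma_H A B ->
    iGLH (Imp (Box A) (Box B))
| iGLH_presb : forall A B, preserv iGL Gamma_H A B ->
    iGLH (Box (Imp (Box A) (Box B)))
| iGLH_mp : forall A B, iGLH (Imp A B) -> iGLH A -> iGLH B.

Inductive iGLHbox : logic :=
| iGLHb_base : forall A, iGL A -> iGLHbox A
| iGLHb_pres : forall A B, preserv iGL S_NNILbox A B ->
    iGLHbox (Imp (Box A) (Box B))
| iGLHb_presb : forall A B, preserv iGL S_NNILbox A B ->
    iGLHbox (Box (Imp (Box A) (Box B)))
| iGLHb_mp : forall A B, iGLHbox (Imp A B) -> iGLHbox A -> iGLHbox B.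

(* Main.v *)
Require Import Defs.
From Stdlib Require Import List Arith Lia Classical ClassicalEpsilon.
From Stdlib Require Import FunctionalExtensionality PropExtensionality Cantor.
Import ListNotations.

(** Truth sets below are sets of subformulas of A. A source world is a prime iGL-theory w
    containing some E in [Gamma_H]; its locus is the set of truth sets of the prime theories
    that contain E and every S-NNIL(box) formula of w. Because E is projective, a locus g
    is closed under adding a new root with the parameters and boxes of w and suitably chosen
    variables. A failed box D of w is witnessed by some E' in [Gamma_H] proving the
    formula chi_h for a family h included in g: otherwise preservativity and Loeb's axiom
    would give "box chi_h implies box D" in iGLH. There are only finitely many candidates
    for such implications, so they can be required of all worlds in advance ([Pstar]).

    On the target side, fresh parameters y_g say that truth sets stay in g, and fresh
    parameters r_D stand for "box gamma(D)", which avoids a fixed point. The closure of the loci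
    becomes an NNIL condition on colours, and under it Ghilardi's iteration turns the
    formula "y_g implies chi_g, for all g" into a unifier gamma. *)

(** * Finite sets as lists *)

(** Arbitrary predicates are decided classically. Equivalent predicates give the same list, so truth
    sets can be compared by plain equality. *)
Definition filt {X} (P : X -> Prop) (l : list X) : list X :=
  filter (fun x => if excluded_middle_informative (P x) then true else false) l.

Lemma in_filt {X} (P : X -> Prop) l x : In x (filt P l) <-> In x l /\ P x.
Proof.
  unfold filt; rewrite filter_In.
  destruct (excluded_middle_informative (P x)); intuition congruence.
Qed.

Lemma filt_ext {X} (P Q : X -> Prop) l :
  (forall x, In x l -> (P x <-> Q x)) -> filt P l = filt Q l.
Proof.
  intros H; apply filter_ext_in; intros x Hx; specialize (H x Hx).
  destruct (excluded_middle_informative (P x)), (excluded_middle_informative (Q x));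
    tauto.
Qed.

Fixpoint sublists {X} (l : list X) : list (list X) :=
  match l with
  | [] => [[]]
  | a :: l' => sublists l' ++ map (cons a) (sublists l')
  end.

Lemma filt_sublists {X} (P : X -> Prop) l : In (filt P l) (sublists l).
Proof.
  induction l as [|a l IH]; simpl; [now left|].
  unfold filt; simpl; apply in_or_app.
  destruct (excluded_middle_informative (P a)); [right; now apply in_map|now left].
Qed.

Lemma sublists_incl {X} (l s : list X) : In s (sublists l) -> incl s l.
Proof.
  revert s; induction l as [|a l IH]; simpl; intros s Hs.
  - destruct Hs as [<-|[]]; intros x [].
  - apply in_app_or in Hs as [Hs|Hs]; [now apply incl_tl, IH|].
    apply in_map_iff in Hs as (t & <- & Ht).
    intros x [<-|Hx]; [now left|right; now apply (IH t)].
Qed.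

Definition cnt {X} (P : X -> Prop) (l : list X) : nat := length (filt P l).

Lemma cnt_cons {X} (P : X -> Prop) a l :
  (P a /\ cnt P (a :: l) = S (cnt P l)) \/ (~ P a /\ cnt P (a :: l) = cnt P l).
Proof.
  unfold cnt, filt; simpl.
  destruct (excluded_middle_informative (P a)); [left|right]; auto.
Qed.

Lemma cnt_length {X} (P : X -> Prop) l : cnt P l <= length l.
Proof. apply filter_length_le. Qed.

Lemma cnt_mono {X} (P Q : X -> Prop) l :
  (forall x, In x l -> P x -> Q x) -> cnt P l <= cnt Q l.
Proof.
  induction l as [|a l IH]; intros H; [now unfold cnt|].
  specialize (IH (fun x Hx => H x (or_intror Hx))).
  specialize (H a (or_introl eq_refl)).
  destruct (cnt_cons P a l) as [[? ->]|[? ->]], (cnt_cons Q a l) as [[? ->]|[? ->]];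
    try lia; tauto.
Qed.

(** A proper inclusion would raise the count. Equality of ranks thereby becomes equality of sets. *)
Lemma cnt_mono_eq {X} (P Q : X -> Prop) l :
  (forall x, In x l -> P x -> Q x) -> cnt Q l <= cnt P l ->
  forall x, In x l -> Q x -> P x.
Proof.
  induction l as [|a l IH]; intros H Hc x Hx HQ; [destruct Hx|].
  pose proof (cnt_mono P Q l (fun x Hx => H x (or_intror Hx))) as Hm.
  specialize (IH (fun x Hx => H x (or_intror Hx))).
  specialize (H a (or_introl eq_refl)).
  destruct (cnt_cons P a l) as [[? E1]|[? E1]], (cnt_cons Q a l) as [[? E2]|[? E2]];
    rewrite E1, E2 in Hc; try tauto; try lia;
    (destruct Hx as [<-|Hx]; [tauto|apply IH; auto; lia]).
Qed.

Fixpoint pos {X} (l : list X) (a : X) : nat :=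
  match l with
  | [] => 0
  | b :: l' => if excluded_middle_informative (b = a) then 0 else S (pos l' a)
  end.

Lemma pos_inj {X} (l : list X) a b : In a l -> In b l -> pos l a = pos l b -> a = b.
Proof.
  induction l as [|c l IH]; simpl; [tauto|].
  intros Ha Hb.
  destruct (excluded_middle_informative (c = a)), (excluded_middle_informative (c = b));
    try congruence; intros E; injection E; intuition congruence.
Qed.

(** The empty conjunction is an argument because [Top] is an implication and hence never a box
    translation. Formulas meant for [S_NNILbox] start from [Box Top]. *)
Fixpoint bigand (base : form) (l : list form) : form :=
  match l with [] => base | A :: l' => And A (bigand base l') end.

Fixpoint bigor (l : list form) : form :=
  match l with [] => Bot | A :: l' => Or A (bigor l') end.

(** * Prime theories *)

Fixpoint code (A : form) : nat :=
  match A with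
  | Var n => to_nat (0, n)
  | Par n => to_nat (1, n)
  | Bot => to_nat (2, 0)
  | And B C => to_nat (3, to_nat (code B, code C))
  | Or B C => to_nat (4, to_nat (code B, code C))
  | Imp B C => to_nat (5, to_nat (code B, code C))
  | Box B => to_nat (6, code B)
  end.

#[local] Opaque to_nat.

Lemma code_inj A B : code A = code B -> A = B.
Proof.
  revert B; induction A; intros [] H; cbn [code] in H; apply to_nat_inj in H;
    try discriminate H; try reflexivity; injection H; clear H; intro H;
    try (apply to_nat_inj in H; injection H; clear H; intros);
    f_equal; auto.
Qed.

(** Without a necessitation rule the deduction theorem holds, and boxed formulas behave like
    atoms. *)
Inductive Der (G : form -> Prop) : form -> Prop :=
| Der_in : forall A, G A -> Der G A
| Der_ipc : forall A, ax_IPC A -> Der G A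
| Der_mp : forall A B, Der G (Imp A B) -> Der G A -> Der G B.

Lemma Der_mono (G H : form -> Prop) A :
  (forall C, G C -> H C) -> Der G A -> Der H A.
Proof. induction 2; eauto using Der. Qed.

Lemma Der_K (G : form -> Prop) A B : Der G B -> Der G (Imp A B).
Proof. intros H; eapply Der_mp; [apply Der_ipc, ipc1|exact H]. Qed.

Lemma Der_deduction (G : form -> Prop) A B :
  Der (fun C => G C \/ C = A) B -> Der G (Imp A B).
Proof.
  induction 1 as [C [HC| ->]|C HC|C D _ IH1 _ IH2].
  - now apply Der_K, Der_in.
  - eapply Der_mp; [eapply Der_mp; [apply Der_ipc, (ipc2 A (Imp A A) A)|]|];
      apply Der_ipc, ipc1.
  - now apply Der_K, Der_ipc.
  - eapply Der_mp; [eapply Der_mp; [apply Der_ipc, ipc2|exact IH1]|exact IH2].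
Qed.

Record prime (T : logic) (v : form -> Prop) : Prop := {
  prime_base : forall A, T A -> v A;
  prime_ipc : forall A, ax_IPC A -> v A;
  prime_mp : forall A B, v (Imp A B) -> v A -> v B;
  prime_or : forall A B, v (Or A B) -> v A \/ v B;
  prime_bot : ~ v Bot }.

Lemma prime_And T v A B : prime T v -> (v (And A B) <-> v A /\ v B).
Proof.
  intros Hv; split; [intros H; split|intros [H1 H2]].
  - exact (prime_mp _ _ Hv _ _ (prime_ipc _ _ Hv _ (ipc3 A B)) H).
  - exact (prime_mp _ _ Hv _ _ (prime_ipc _ _ Hv _ (ipc4 A B)) H).
  - eapply prime_mp; [exact Hv|eapply prime_mp; [exact Hv| |exact H1]|exact H2].
    apply (prime_ipc _ _ Hv), ipc5.
Qed.

Lemma prime_Or T v A B : prime T v -> (v (Or A B) <-> v A \/ v B).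
Proof.
  intros Hv; split; [apply (prime_or _ _ Hv)|].
  intros [H|H].
  - exact (prime_mp _ _ Hv _ _ (prime_ipc _ _ Hv _ (ipc6 A B)) H).
  - exact (prime_mp _ _ Hv _ _ (prime_ipc _ _ Hv _ (ipc7 A B)) H).
Qed.

Lemma prime_K T v A B : prime T v -> v B -> v (Imp A B).
Proof. intros Hv H; exact (prime_mp _ _ Hv _ _ (prime_ipc _ _ Hv _ (ipc1 B A)) H). Qed.

Lemma prime_Top T v : prime T v -> v Top.
Proof. intros Hv; apply (prime_ipc _ _ Hv), ipc9. Qed.

Section Lindenbaum.
Variables (G : form -> Prop) (X : form).

(** Lindenbaum's construction: step [m] concerns only the formula with code [m], if any, and accepts
    it when [X] stays underivable. *)
Fixpoint stage (n : nat) : form -> Prop :=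
  match n with
  | 0 => G
  | S m => fun C => stage m C \/
      (code C = m /\ ~ Der (fun B => stage m B \/ B = C) X)
  end.

Definition limit (C : form) : Prop := exists n, stage n C.

Lemma stage_le n m C : n <= m -> stage n C -> stage m C.
Proof. induction 1; simpl; auto. Qed.

Hypothesis HX : ~ Der G X.

Lemma stage_consistent n : ~ Der (stage n) X.
Proof.
  induction n as [|n IH]; [exact HX|]; intros H.
  destruct (classic (exists C, code C = n /\ ~ Der (fun B => stage n B \/ B = C) X))
    as [(C & HC & HD)|Hno].
  - apply HD; revert H; apply Der_mono; intros B [HB|[HB _]]; [now left|].
    right; apply code_inj; congruence.
  - apply IH; revert H; apply Der_mono; intros B [HB|HB]; [assumption|].
    exfalso; eauto.
Qed.

Lemma Der_limit A : Der limit A -> exists n, Der (stage n) A.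
Proof.
  induction 1 as [A [n HA]|A HA|A B _ [n IH1] _ [m IH2]].
  - exists n; now apply Der_in.
  - exists 0; now apply Der_ipc.
  - exists (max n m); eapply Der_mp.
    + eapply Der_mono; [intros C; apply (stage_le n); lia|exact IH1].
    + eapply Der_mono; [intros C; apply (stage_le m); lia|exact IH2].
Qed.

Lemma limit_consistent : ~ Der limit X.
Proof. intros H; apply Der_limit in H as [n H]; exact (stage_consistent n H). Qed.

(** A rejected formula makes [X] derivable at its own step. This gives primeness: two rejected
    disjuncts both imply [X], hence so does their disjunction. *)
Lemma limit_out C : ~ limit C -> Der limit (Imp C X).
Proof.
  intros HC.
  destruct (classic (Der (fun B => stage (code C) B \/ B = C) X)) as [H|H].
  - apply Der_deduction in H; revert H; apply Der_mono; intros B HB; now exists (code C).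
  - exfalso; apply HC; exists (S (code C)); right; auto.
Qed.

Lemma limit_closed C : Der limit C -> limit C.
Proof.
  intros HC; apply NNPP; intros Hn; apply limit_consistent.
  eapply Der_mp; [apply (limit_out _ Hn)|exact HC].
Qed.

End Lindenbaum.

Lemma prime_extension (T : logic) (G : form -> Prop) X :
  ~ Der (fun C => T C \/ G C) X ->
  exists v, prime T v /\ (forall C, G C -> v C) /\ ~ v X.
Proof.
  set (TG := fun C => T C \/ G C); intros HX.
  pose proof (limit_closed TG X HX) as Hcl.
  exists (limit TG X); split; [split|split].
  - intros A HA; exists 0; now left.
  - intros A HA; now apply Hcl, Der_ipc.
  - intros A B HAB HA; apply Hcl; eapply Der_mp; apply Der_in; eassumption.
  - intros A B HAB; apply NNPP; intros Hn.
    apply (limit_consistent TG X HX).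
    eapply Der_mp; [eapply Der_mp; [eapply Der_mp; [apply Der_ipc, ipc8|]|]|
      apply Der_in, HAB]; apply limit_out; tauto.
  - intros Hb; apply (limit_consistent TG X HX).
    eapply Der_mp; [apply Der_ipc, ipc9|apply Der_in, Hb].
  - intros C HC; exists 0; now right.
  - intros HC; apply (limit_consistent TG X HX), Der_in, HC.
Qed.

Lemma prime_Imp_witness T v B C : prime T v -> ~ v (Imp B C) ->
  exists v', prime T v' /\ (forall A, v A -> v' A) /\ v' B /\ ~ v' C.
Proof.
  intros Hv HBC.
  destruct (prime_extension T (fun D => v D \/ D = B) C) as (v' & H1 & H2 & H3).
  - intros HD; apply HBC.
    assert (Hcl : forall A, Der v A -> v A)
      by (induction 1; [assumption|now apply (prime_ipc _ _ Hv)|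
                        eapply prime_mp; eassumption]).
    apply Hcl, Der_deduction; revert HD; apply Der_mono.
    intros A [HA|HA]; [left; now apply (prime_base _ _ Hv)|assumption].
  - exists v'; split; [exact H1|split; [auto|split; [|exact H3]]]; auto.
Qed.

Definition closed_logic (T : logic) : Prop :=
  (forall A, ax_IPC A -> T A) /\ (forall A B, T (Imp A B) -> T A -> T B).

Lemma closed_Der T A : closed_logic T -> Der T A -> T A.
Proof. intros [H1 H2]; induction 1; eauto. Qed.

(** This replaces Hilbert-style derivations: implications are proved by following an arbitrary prime
    theory. *)
Lemma prime_complete T A B : closed_logic T ->
  (forall v, prime T v -> v A -> v B) -> T (Imp A B).
Proof.
  intros HT H; apply NNPP; intros Hn.
  destruct (prime_extension T (fun D => D = A) B) as (v & H1 & H2 & H3).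
  - intros HD; apply Hn, (closed_Der _ _ HT), Der_deduction, HD.
  - apply H3, H; auto.
Qed.

Lemma prime_complete0 T B : closed_logic T -> (forall v, prime T v -> v B) -> T B.
Proof.
  intros HT H; pose proof HT as [H1 H2]; apply (H2 Top); [|exact (H1 _ (ipc9 Bot))].
  apply (prime_complete T Top B HT); intros v Hv _; exact (H v Hv).
Qed.

Lemma prime_bigand T v base l : prime T v -> v base ->
  (v (bigand base l) <-> forall A, In A l -> v A).
Proof.
  intros Hv Hb; induction l as [|B l IH]; simpl; [intuition|].
  rewrite (prime_And _ _ _ _ Hv), IH; split.
  - intros [H1 H2] A [<-|HA]; auto.
  - auto.
Qed.

(** * Intuitionistic Kripke models *)

(* Boxed formulas are atoms here: only [val] decides them. *)
Fixpoint forces {W : Type} (le : W -> W -> Prop) (val : W -> form -> Prop) (w : W)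
    (A : form) : Prop :=
  match A with
  | Bot => False
  | And B C => forces le val w B /\ forces le val w C
  | Or B C => forces le val w B \/ forces le val w C
  | Imp B C => forall w', le w w' -> forces le val w' B -> forces le val w' C
  | _ => val w A
  end.

Section Kripke.
Context {W : Type} (le : W -> W -> Prop).
Hypothesis le_refl : forall w, le w w.
Hypothesis le_trans : forall u v w, le u v -> le v w -> le u w.

Local Notation forces := (forces le).

Definition monotone (val : W -> form -> Prop) : Prop :=
  forall w w' A, le w w' -> val w A -> val w' A.

Lemma forces_mono val A w w' :
  monotone val -> le w w' -> forces val w A -> forces val w' A.
Proof.
  intros Hm Hle; induction A; simpl; eauto; intuition eauto.
Qed.

Lemma forces_ipc val A w : monotone val -> ax_IPC A -> forces val w A.
Proof.
  intros Hm [B C|B C D|B C|B C|B C|B C|B C|B C D|B]; simpl; try tauto.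
  - intros u _ HB v Hv _; exact (forces_mono _ _ _ _ Hm Hv HB).
  - intros u _ H1 v Hv H2 z Hz HB; apply (H1 z); eauto.
  - intros u _ HB v Hv HC; split; [exact (forces_mono _ _ _ _ Hm Hv HB)|exact HC].
  - intros u _ H1 v Hv H2 z Hz [HB|HC]; [apply (H1 z)|apply (H2 z)]; eauto.
Qed.

Lemma forces_bigand val w base l : forces val w base ->
  (forces val w (bigand base l) <-> forall A, In A l -> forces val w A).
Proof.
  intros Hb; induction l as [|B l IH]; simpl; [intuition|].
  rewrite IH; split; [intros [H1 H2] A [<-|HA]; auto|auto].
Qed.

Lemma forces_bigor val w l :
  forces val w (bigor l) <-> exists A, In A l /\ forces val w A.
Proof.
  induction l as [|B l IH]; simpl; [split; [tauto|intros (A & [] & _)]|].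
  rewrite IH; split.
  - intros [H|(A & H1 & H2)]; eauto.
  - intros (A & [<-|H1] & H2); eauto.
Qed.

Lemma forces_Top val w : forces val w Top.
Proof. intros u _ []. Qed.

(** The valuation pulled back along [th]. Boxes keep their value, which matches the outer
    substitution. *)
Definition vsub (val : W -> form -> Prop) (th : subst) (w : W) (A : form) : Prop :=
  match A with Var x => forces val w (th x) | _ => val w A end.

Lemma vsub_mono val th : monotone val -> monotone (vsub val th).
Proof.
  intros Hm w w' [] Hle; simpl; try apply (Hm _ _ _ Hle).
  apply (forces_mono _ _ _ _ Hm Hle).
Qed.

Lemma forces_vsub val th A w :
  forces (vsub val th) w A <-> forces val w (app_osubst th A).
Proof.
  revert w; induction A; intros w; simpl; try tauto.
  - rewrite IHA1, IHA2; tauto.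
  - rewrite IHA1, IHA2; tauto.
  - split; intros H w' Hw'; specialize (H w' Hw'); rewrite ?IHA1, ?IHA2 in *; auto.
Qed.

Definition truths (val : W -> form -> Prop) (f : form -> form) (sub : list form)
    (w : W) : list form := filt (fun C => forces val w (f C)) sub.

(* Excludes every truth set outside [g]. Sublists that are not of the form
   [filt _ sub] are no truth sets and must not be excluded. *)
Definition chi (f : form -> form) (sub : list form) (g : list (list form)) : form :=
  bigand Top
    (map (fun t => Imp (bigand Top (map f t))
                       (bigor (map f (filt (fun C => ~ In C t) sub))))
       (filt (fun t => ~ In t g /\ t = filt (fun C => In C t) sub) (sublists sub))).

Lemma truths_canonical val f sub w :
  truths val f sub w = filt (fun C => In C (truths val f sub w)) sub.
Proof.
  apply filt_ext; intros C HC; unfold truths; rewrite in_filt; tauto.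
Qed.

(** A point with truth set [t] outside [g] forces the premise of the conjunct for [t] and none of
    its disjuncts. Conversely, such a point has truth set exactly [t]. *)
Lemma forces_chi val f sub g w :
  forces val w (chi f sub g) <->
  forall w', le w w' -> In (truths val f sub w') g.
Proof.
  unfold chi; rewrite forces_bigand by apply forces_Top; split.
  - intros H w' Hw'; apply NNPP; intros Hn.
    set (t := truths val f sub w') in *.
    specialize (H _ (in_map _ _ t
      (proj2 (in_filt _ _ _)
         (conj (filt_sublists _ sub) (conj Hn (truths_canonical val f sub w')))))).
    assert (Hc : forces val w' (bigand Top (map f t))).
    { apply forces_bigand; [apply forces_Top|]; intros A HA.
      apply in_map_iff in HA as (C & <- & HC); apply in_filt in HC; tauto. }
    apply (H w' Hw'), forces_bigor in Hc as (A & HA & HF).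
    apply in_map_iff in HA as (C & <- & HC); apply in_filt in HC as [HC1 HC2].
    apply HC2, in_filt; auto.
  - intros H A HA; apply in_map_iff in HA as (t & <- & Ht).
    apply in_filt in Ht as (Ht & Hg & Hcan).
    intros w' Hw' Hc; apply forces_bigor.
    apply NNPP; intros Hn; apply Hg.
    replace t with (truths val f sub w'); [auto|].
    rewrite Hcan; apply filt_ext; intros C HC; split.
    + intros HF; apply NNPP; intros HCt; apply Hn; exists (f C); split; [|exact HF].
      apply in_map, in_filt; auto.
    + intros HCt; rewrite forces_bigand in Hc by apply forces_Top.
      apply Hc, in_map, HCt.
Qed.

End Kripke.

(** * The canonical model of prime theories above a given one *)

Definition cone (T : logic) (u : form -> Prop) : Type :=
  {v : form -> Prop | prime T v /\ forall A, u A -> v A}.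

Definition cone_le {T u} (v v' : cone T u) : Prop :=
  forall A, proj1_sig v A -> proj1_sig v' A.

Lemma cone_refl {T u} (v : cone T u) : cone_le v v.
Proof. now intros A. Qed.

Lemma cone_trans {T u} (v1 v2 v3 : cone T u) :
  cone_le v1 v2 -> cone_le v2 v3 -> cone_le v1 v3.
Proof. intros H1 H2 A HA; auto. Qed.

Lemma cone_Imp {T u} (v : cone T u) B C :
  proj1_sig v (Imp B C) <->
  forall v' : cone T u, cone_le v v' -> proj1_sig v' B -> proj1_sig v' C.
Proof.
  split.
  - intros H v' Hle HB; eapply prime_mp; [apply (proj2_sig v')|apply Hle, H|exact HB].
  - intros H; apply NNPP; intros Hn; destruct v as [v [Hv Hu]]; simpl in *.
    destruct (prime_Imp_witness _ _ _ _ Hv Hn) as (v' & H1 & H2 & H3 & H4).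
    apply H4; apply (H (exist _ v' (conj H1 (fun A HA => H2 A (Hu A HA))))).
    + exact H2.
    + exact H3.
Qed.

Lemma cone_forces {T u} A (v : cone T u) :
  forces cone_le (fun v => proj1_sig v) v A <-> proj1_sig v A.
Proof.
  revert v; induction A; intros v; simpl; try tauto;
    pose proof (proj1 (proj2_sig v)) as Hv.
  - pose proof (prime_bot _ _ Hv); tauto.
  - rewrite IHA1, IHA2, (prime_And _ _ _ _ Hv); tauto.
  - rewrite IHA1, IHA2, (prime_Or _ _ _ _ Hv); tauto.
  - rewrite cone_Imp; split; intros H v' Hv'; specialize (H v' Hv');
      rewrite ?IHA1, ?IHA2 in *; auto.
Qed.

Lemma prime_chi T v sub g : prime T v ->
  (v (chi (fun C => C) sub g) <->
   forall v', prime T v' -> (forall A, v A -> v' A) -> In (filt v' sub) g).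
Proof.
  intros Hv.
  set (v0 := exist _ v (conj Hv (fun A HA => HA)) : cone T v).
  change (v (chi (fun C => C) sub g)) with (proj1_sig v0 (chi (fun C => C) sub g)).
  rewrite <- (cone_forces _ v0), forces_chi.
  assert (Ht : forall w : cone T v,
    truths cone_le (fun v => proj1_sig v) (fun C => C) sub w = filt (proj1_sig w) sub)
    by (intros w; apply filt_ext; intros C _; apply cone_forces).
  split.
  - intros H v' H1 H2; specialize (H (exist _ v' (conj H1 H2)) H2).
    now rewrite Ht in H.
  - intros H [w' [H1 H2]] Hle; rewrite Ht; now apply H.
Qed.

(** * Modal facts *)

Lemma iGL_closed : closed_logic iGL.
Proof.
  split; [intros A HA; now apply iGL_ax, gl_k4, k4_ipc|apply iGL_mp].
Qed.

Lemma iGL_necessitation A : iGL A -> iGL (Box A).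
Proof.
  induction 1 as [A HA|A HA|A B _ IH1 _ IH2].
  - now apply iGL_nec.
  - eapply iGL_mp; [apply iGL_ax, gl_k4, k4_4|now apply iGL_nec].
  - eapply iGL_mp; [eapply iGL_mp; [apply iGL_ax, gl_k4, k4_K|exact IH1]|exact IH2].
Qed.

Lemma prime_weaken (T T' : logic) v :
  (forall A, T A -> T' A) -> prime T' v -> prime T v.
Proof. intros H [H1 H2 H3 H4 H5]; constructor; auto. Qed.

Section PrimeGL.
Context (v : form -> Prop) (Hv : prime iGL v).

Lemma prime_thm_mp A B : iGL (Imp A B) -> v A -> v B.
Proof. intros H; apply (prime_mp _ _ Hv), (prime_base _ _ Hv), H. Qed.

Lemma prime_box_mp A B : v (Box (Imp A B)) -> v (Box A) -> v (Box B).
Proof.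
  intros H; apply (prime_mp _ _ Hv); revert H.
  apply prime_thm_mp, iGL_ax, gl_k4, k4_K.
Qed.

Lemma prime_box_thm A : iGL A -> v (Box A).
Proof. intros H; now apply (prime_base _ _ Hv), iGL_necessitation. Qed.

Lemma prime_box_imp A B : iGL (Imp A B) -> v (Box A) -> v (Box B).
Proof. intros H; apply prime_box_mp, prime_box_thm, H. Qed.

Lemma prime_box_4 A : v (Box A) -> v (Box (Box A)).
Proof. apply prime_thm_mp, iGL_ax, gl_k4, k4_4. Qed.

Lemma prime_box_par p : v (Par p) -> v (Box (Par p)).
Proof. apply prime_thm_mp, iGL_ax, gl_k4, k4_par. Qed.

Lemma prime_box_lob A : v (Box (Imp (Box A) A)) -> v (Box A).
Proof. apply prime_thm_mp, iGL_ax, gl_lob. Qed.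

Lemma prime_box_And A B : v (Box (And A B)) <-> v (Box A) /\ v (Box B).
Proof.
  split; [intros H; split; revert H; apply prime_box_imp, iGL_closed; constructor|].
  intros [HA HB]; eapply prime_box_mp; [|exact HB].
  revert HA; apply prime_box_imp, iGL_closed, ipc5.
Qed.

Lemma prime_boxdot A : v (Boxdot A) -> v (Box (Boxdot A)).
Proof.
  unfold Boxdot; rewrite (prime_And _ _ _ _ Hv), prime_box_And.
  intros [_ H]; split; [exact H|now apply prime_box_4].
Qed.

(** Variables and implications are translated together with their box; parameters have their axiom,
    and boxes have 4. *)
Lemma prime_boxtr B : v (boxtr B) -> v (Box (boxtr B)).
Proof.
  induction B; cbn [boxtr].
  - apply prime_boxdot.
  - apply prime_box_par.
  - intros H; destruct (prime_bot _ _ Hv H).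
  - rewrite prime_box_And, (prime_And _ _ _ _ Hv); tauto.
  - rewrite (prime_Or _ _ _ _ Hv); intros [H|H];
      [apply IHB1 in H|apply IHB2 in H]; revert H;
      apply prime_box_imp, iGL_closed; constructor.
  - apply prime_boxdot.
  - apply prime_box_4.
Qed.

(** The formulas whose box lies in [v] are closed under derivation, so they do not derive [X]. *)
Lemma prime_box_extension X : ~ v (Box X) ->
  exists v', prime iGL v' /\ (forall A, v (Box A) -> v' A) /\ ~ v' X.
Proof.
  intros HX; apply prime_extension; intros HD; apply HX; clear HX.
  induction HD as [A [HA|HA]|A HA|A B _ IH1 _ IH2]; auto.
  - now apply prime_box_thm.
  - now apply prime_box_thm, iGL_closed.
  - exact (prime_box_mp _ _ IH1 IH2).
Qed.

End PrimeGL.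

Lemma parb_boxtr A : parb A -> boxtr A = A.
Proof. now intros [->|[[p ->]|[B ->]]]. Qed.

Lemma SN_parb A : parb A -> S_NNILbox A.
Proof.
  intros H; split; [exists A; now rewrite parb_boxtr|].
  split; [apply NNIL_at; now left|now apply L0_in].
Qed.

Lemma SN_And A B : S_NNILbox A -> S_NNILbox B -> S_NNILbox (And A B).
Proof.
  intros [[A' ->] [HA1 HA2]] [[B' ->] [HB1 HB2]].
  split; [now exists (And A' B')|split; [now apply NNIL_and|now apply L0_and]].
Qed.

Lemma SN_bigand base l : S_NNILbox base ->
  (forall A, In A l -> S_NNILbox A) -> S_NNILbox (bigand base l).
Proof. induction l; simpl; auto using SN_And. Qed.

(** These formulas are fixed by the box translation and lie in both [NI] and [NNIL]. A boxdotted
    implication between two of them is therefore literally in [S_NNILbox]. *)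
Inductive lattice_parb : form -> Prop :=
| lp_parb : forall A, parb A -> lattice_parb A
| lp_and : forall A B, lattice_parb A -> lattice_parb B -> lattice_parb (And A B)
| lp_or : forall A B, lattice_parb A -> lattice_parb B -> lattice_parb (Or A B).

Lemma lattice_parb_props A : lattice_parb A ->
  boxtr A = A /\ NI A /\ NNIL A /\ L0 parb A.
Proof.
  induction 1 as [A HA|A B _ (E1 & ? & ? & ?) _ (E2 & ? & ? & ?)
                 |A B _ (E1 & ? & ? & ?) _ (E2 & ? & ? & ?)].
  - repeat split; [now apply parb_boxtr|now apply NI_at; left|
      now apply NNIL_at; left|now apply L0_in].
  - cbn [boxtr]; rewrite E1, E2; auto using NI, NNIL, L0.
  - cbn [boxtr]; rewrite E1, E2; auto using NI, NNIL, L0.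
Qed.

Lemma SN_boxdot_Imp A B : lattice_parb A -> lattice_parb B ->
  S_NNILbox (Boxdot (Imp A B)).
Proof.
  intros HA HB; apply lattice_parb_props in HA as (E1 & ? & _ & ?), HB as (E2 & _ & ? & ?).
  split; [exists (Imp A B); cbn [boxtr]; now rewrite E1, E2|].
  assert (parb (Box (Imp A B))) by (right; right; eauto).
  split; [apply NNIL_and; [now apply NNIL_imp|apply NNIL_at; now left]|].
  apply L0_and; [now apply L0_imp|now apply L0_in].
Qed.

Lemma lattice_parb_bigand base l : parb base ->
  (forall A, In A l -> parb A) -> lattice_parb (bigand base l).
Proof. induction l; simpl; auto using lattice_parb. Qed.

Lemma lattice_parb_bigor l : (forall A, In A l -> parb A) -> lattice_parb (bigor l).
Proof.
  induction l; simpl; [intros; now apply lp_parb; left|auto using lattice_parb].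
Qed.

Lemma parb_Par p : parb (Par p).
Proof. right; left; eauto. Qed.

Lemma parb_Box B : parb (Box B).
Proof. right; right; eauto. Qed.

Lemma prime_SN_box v X : prime iGL v -> S_NNILbox X -> v X -> v (Box X).
Proof. intros Hv [[B ->] _]; now apply prime_boxtr. Qed.

(** Boxes are left untouched, so the boxed axioms and the proper modal axioms are fixed; an IPC
    instance becomes another IPC instance. *)
Lemma iGL_osubst th A : iGL A -> iGL (app_osubst th A).
Proof.
  induction 1 as [A HA|A HA|A B _ IH1 _ IH2].
  - apply iGL_ax.
    destruct HA as [B HB|B]; [apply gl_k4|apply gl_lob].
    destruct HB as [C HC| | |]; [|apply k4_K|apply k4_4|apply k4_par].
    apply k4_ipc; destruct HC; constructor.
  - now apply iGL_nec.
  - eapply iGL_mp; [exact IH1|exact IH2].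
Qed.

Lemma L0_parb_osubst th X : L0 parb X -> app_osubst th X = X.
Proof.
  induction 1 as [A [->|[[p ->]|[B ->]]]| |A B _ IH1 _ IH2|A B _ IH1 _ IH2|A B _ IH1 _ IH2];
    cbn [app_osubst]; congruence.
Qed.

Lemma prime_Imp_iff T v B C : prime T v ->
  (v (Imp B C) <->
   forall v', prime T v' -> (forall A, v A -> v' A) -> v' B -> v' C).
Proof.
  intros Hv; split.
  - intros H v' Hv' Hle HB; exact (prime_mp _ _ Hv' _ _ (Hle _ H) HB).
  - intros H; apply NNPP; intros Hn.
    destruct (prime_Imp_witness _ _ _ _ Hv Hn) as (v' & H1 & H2 & H3 & H4).
    exact (H4 (H v' H1 H2 H3)).
Qed.

(** Over [E] the substitution is provably the identity on variables, and [E] persists to the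
    extensions met in the implication case. *)
Lemma prime_osubst_iff E th v C :
  (forall x, iGL (Imp E (Iff (Var x) (th x)))) ->
  prime iGL v -> v E -> (v (app_osubst th C) <-> v C).
Proof.
  intros Hth; revert v; induction C; intros v Hv HE; cbn [app_osubst]; try tauto.
  - apply (prime_thm_mp v Hv _ _ (Hth n)) in HE; apply (prime_And _ _ _ _ Hv) in HE.
    destruct HE as [H1 H2]; split; apply (prime_mp _ _ Hv); assumption.
  - rewrite !(prime_And _ _ _ _ Hv), IHC1, IHC2; tauto.
  - rewrite !(prime_Or _ _ _ _ Hv), IHC1, IHC2; tauto.
  - rewrite !(prime_Imp_iff _ _ _ _ Hv); split; intros H v' H1 H2;
      specialize (H v' H1 H2); rewrite ?IHC1, ?IHC2 in *; auto.
Qed.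

Lemma Gamma_H_Top : Gamma_H Top.
Proof.
  assert (HT : iGL Top) by (apply iGL_closed; apply ipc9).
  split.
  - apply (prime_complete _ _ _ iGL_closed); intros v Hv _; now apply prime_box_thm.
  (* The identity projects [Top]; as [Top] is not in [S_set], its equivalent [boxtr Top] is taken as
     the image. *)
  - exists Var, (boxtr Top); split; [|split].
    + apply SN_boxdot_Imp; apply lp_parb; now left.
    + apply (prime_complete0 _ _ iGL_closed); intros v Hv.
      apply (prime_And _ _ _ _ Hv); split; apply (prime_K _ _ _ _ Hv).
      * apply (prime_And _ _ _ _ Hv); split; [exact (prime_Top _ _ Hv)|].
        now apply prime_box_thm.
      * exact (prime_Top _ _ Hv).
    + intros x; apply (prime_complete _ _ _ iGL_closed); intros v Hv _.
      apply (prime_And _ _ _ _ Hv).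
      split; apply (prime_Imp_iff _ _ _ _ Hv); auto.
Qed.

(** * Adding a root below a set of prime theories *)

(** Truth at a new root below the theories in [F]. Parameters and boxes are copied from [w]; all
    variables fail until the projective substitution is applied. *)
Fixpoint root (w : form -> Prop) (F : (form -> Prop) -> Prop) (A : form) : Prop :=
  match A with
  | Var _ => False
  | Bot => False
  | And B C => root w F B /\ root w F C
  | Or B C => root w F B \/ root w F C
  | Imp B C => (forall m, F m -> m (Imp B C)) /\ (root w F B -> root w F C)
  | _ => w A
  end.

Section Root.
Context (w : form -> Prop) (F : (form -> Prop) -> Prop).
Hypothesis Hw : prime iGL w.
Hypothesis HF : forall m, F m -> prime iGL m.
Hypothesis HwF : forall m, F m -> forall X, S_NNILbox X -> w X -> m X.

Lemma root_sub m A : F m -> root w F A -> m A.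
Proof.
  intros Hm; pose proof (HF m Hm) as Hp; induction A; cbn [root]; try tauto.
  - apply (HwF m Hm), SN_parb, parb_Par.
  - rewrite (prime_And _ _ _ _ Hp); tauto.
  - rewrite (prime_Or _ _ _ _ Hp); tauto.
  - intros [H _]; now apply H.
  - apply (HwF m Hm), SN_parb, parb_Box.
Qed.

Lemma root_ipc A : ax_IPC A -> root w F A.
Proof.
  intros HA; assert (Hax : forall m, F m -> m A)
    by (intros m Hm; exact (prime_ipc _ _ (HF m Hm) _ HA)).
  assert (Hmp : forall B C, root w F B -> (forall m, F m -> m (Imp B C)) ->
    forall m, F m -> m C)
    by (intros B C HB HBC m Hm;
        exact (prime_mp _ _ (HF m Hm) _ _ (HBC m Hm) (root_sub m B Hm HB))).
  destruct HA; cbn [root] in *; try (split; [exact Hax|tauto]).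
  - split; [exact Hax|]; intros HA; split; [|tauto]; eapply Hmp; [exact HA|exact Hax].
  - split; [exact Hax|]; intros H1.
    assert (H1' := Hmp (Imp A (Imp B C)) _ H1 Hax).
    split; [exact H1'|]; intros H2; split; [|tauto].
    eapply (Hmp (Imp A B)); [exact H2|exact H1'].
  - split; [exact Hax|]; intros HA; split; [|tauto]; eapply Hmp; [exact HA|exact Hax].
  - split; [exact Hax|]; intros H1.
    assert (H1' := Hmp (Imp A C) _ H1 Hax).
    split; [exact H1'|]; intros H2; split; [|tauto].
    eapply (Hmp (Imp B C)); [exact H2|exact H1'].
Qed.

(** The root has the boxes of [w], so modal axioms are inherited from [w]; the clause about [F]
    holds because its members are iGL-theories. *)
Lemma root_prime : prime iGL (root w F).
Proof.
  split.
  - induction 1 as [A HA|A HA|A B _ IH1 _ IH2].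
    + assert (H1 : forall m, F m -> m A)
        by (intros m Hm; apply (prime_base _ _ (HF m Hm)), iGL_ax, HA).
      assert (H2 := prime_base _ _ Hw _ (iGL_ax _ HA)).
      destruct HA as [A HA|A]; [destruct HA as [A HA|A B|A|p]|];
        [now apply root_ipc|cbn [root]; (split; [exact H1|])..].
      * intros HAB; split; [|apply (prime_box_mp w Hw _ _ HAB)].
        intros m Hm; apply (prime_mp _ _ (HF m Hm) _ _ (H1 m Hm)).
        exact (HwF m Hm _ (SN_parb _ (parb_Box _)) HAB).
      * apply (prime_box_4 w Hw).
      * apply (prime_box_par w Hw).
      * apply (prime_box_lob w Hw).
    + exact (prime_base _ _ Hw _ (iGL_nec _ HA)).
    + apply IH1, IH2.
  - exact root_ipc.
  - intros A B [_ H]; exact H.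
  - intros A B H; exact H.
  - intros H; exact H.
Qed.

(** Without variables and implications, truth depends only on parameters and boxes, which the root
    shares with [w]. *)
Lemma root_NI A : NI A -> L0 parb A -> root w F A -> w A.
Proof.
  induction 1 as [A HA|A B _ IH1 _ IH2|A B _ IH1 _ IH2]; intros HL.
  - destruct HA as [[->|[[p ->]|[B ->]]]|[x ->]]; cbn [root]; tauto.
  - inversion HL as [? [E|[[? E]|[? E]]]| | | |]; subst; try discriminate.
    rewrite (prime_And _ _ _ _ Hw); cbn [root]; tauto.
  - inversion HL as [? [E|[[? E]|[? E]]]| | | |]; subst; try discriminate.
    rewrite (prime_Or _ _ _ _ Hw); cbn [root]; tauto.
Qed.

(* NNIL formulas survive because the root has exactly the parameters and boxes of [w]. *)
Lemma root_SN X : S_NNILbox X -> w X -> root w F X.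
Proof.
  assert (HNi : forall C, NNIL C -> match C with
      | And C1 C2 | Or C1 C2 => NNIL C1 /\ NNIL C2
      | Imp C1 C2 => NI C1 /\ NNIL C2 | _ => True end).
  { intros C HC; destruct HC as [C [[->|[[? ->]|[? ->]]]|[? ->]]| | |]; auto. }
  assert (HLi : forall C, L0 parb C -> match C with
      | And C1 C2 | Or C1 C2 | Imp C1 C2 => L0 parb C1 /\ L0 parb C2
      | Var _ => False | _ => True end).
  { intros C HC; destruct HC as [C [->|[[? ->]|[? ->]]]| | | |]; auto. }
  intros [[B ->] [HN HL]].
  induction B; cbn [root]; try (cbn [boxtr]; tauto).
  - apply HLi in HL as [HL _]; destruct (HLi _ HL).
  - intros H; destruct (prime_bot _ _ Hw H).
  - apply HNi in HN; apply HLi in HL; cbn [boxtr root] in *.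
    rewrite (prime_And _ _ _ _ Hw); tauto.
  - apply HNi in HN; apply HLi in HL; cbn [boxtr root] in *.
    rewrite (prime_Or _ _ _ _ Hw); tauto.
  - intros H.
    assert (HX : S_NNILbox (boxtr (Imp B1 B2))) by (split; [now exists (Imp B1 B2)|split; auto]).
    assert (Hsub := fun m Hm => HwF m Hm _ HX H).
    cbn [boxtr] in *; unfold Boxdot in *; cbn [root].
    apply HNi in HN as [HN _]; apply HLi in HL as [HL _].
    apply HNi in HN; apply HLi in HL.
    rewrite (prime_And _ _ _ _ Hw) in H; destruct H as [H1 H2].
    split; [split|exact H2].
    + intros m Hm; specialize (Hsub m Hm).
      rewrite (prime_And _ _ _ _ (HF m Hm)) in Hsub; tauto.
    + intros Ha; apply IHB2; try tauto.
      apply (prime_mp _ _ Hw _ _ H1); apply root_NI; tauto.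
Qed.

End Root.

(** * Source worlds: loci, colours and successors *)

Lemma iGLH_closed : closed_logic iGLH.
Proof.
  split; [intros A HA; apply iGLH_base, iGL_closed, HA|apply iGLH_mp].
Qed.

Lemma iGLH_necessitation A : iGLH A -> iGLH (Box A).
Proof.
  induction 1 as [A HA|A B H|A B H|A B _ IH1 _ IH2].
  - now apply iGLH_base, iGL_necessitation.
  - now apply iGLH_presb.
  - eapply iGLH_mp; [apply iGLH_base, iGL_ax, gl_k4, k4_4|now apply iGLH_presb].
  - eapply iGLH_mp; [eapply iGLH_mp; [|exact IH1]|exact IH2].
    apply iGLH_base, iGL_ax, gl_k4, k4_K.
Qed.

Definition sub_closed (sub : list form) : Prop :=
  forall C, In C sub -> match C with
    | And B D | Or B D | Imp B D => In B sub /\ In D sub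
    | Box B => In B sub
    | _ => True
    end.

Section Source.
Context (sub : list form) (Hsub : sub_closed sub).

Definition vars : list nat :=
  flat_map (fun C => match C with Var x => [x] | _ => [] end) sub.
Definition pars : list nat :=
  flat_map (fun C => match C with Par p => [p] | _ => [] end) sub.
Definition boxes : list form := filt (fun C => exists B, C = Box B) sub.
Definition families : list (list (list form)) := sublists (sublists sub).

Lemma in_vars x : In x vars <-> In (Var x) sub.
Proof.
  unfold vars; rewrite in_flat_map; split.
  - intros (C & HC & Hx); destruct C; simpl in Hx; try tauto.
    destruct Hx as [<-|[]]; exact HC.
  - intros H; exists (Var x); simpl; auto.
Qed.

Lemma in_pars p : In p pars <-> In (Par p) sub.
Proof.
  unfold pars; rewrite in_flat_map; split.
  - intros (C & HC & Hx); destruct C; simpl in Hx; try tauto.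
    destruct Hx as [<-|[]]; exact HC.
  - intros H; exists (Par p); simpl; auto.
Qed.

Definition fresh : nat := S (list_max pars).

Lemma pars_fresh p : In (Par p) sub -> p < fresh.
Proof.
  intros H; apply in_pars in H; unfold fresh.
  pose proof (proj1 (list_max_le pars _) (le_n _)) as Hf.
  rewrite Forall_forall in Hf; specialize (Hf p H); lia.
Qed.

(* Fresh parameters: [box_par B] stands for the boxed formula [B], and
   [fam_par g] announces that the truth set here and later lies in [g]. *)
Definition box_par (B : form) : nat := fresh + 2 * pos sub B.
Definition fam_par (g : list (list form)) : nat := S (fresh + 2 * pos families g).

Definition all_pars : list nat := pars ++ map box_par boxes ++ map fam_par families.

(* Membership in [S_NNILbox] is what both the intuitionistic and the modal
   accessibility relation preserve. *)
Definition locus (E : form) (w : form -> Prop) (t : list form) : Prop :=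
  exists m, prime iGL m /\ m E /\ (forall X, S_NNILbox X -> w X -> m X) /\
            t = filt m sub.

(** The parameters that a source world makes true on the target side. The clauses cannot clash: old
    parameters lie below [fresh], and parity of the offset separates the two fresh kinds. *)
Definition colour (E : form) (w : form -> Prop) (k : nat) : Prop :=
  (exists p, In (Par p) sub /\ k = p /\ w (Par p)) \/
  (exists B, In (Box B) sub /\ k = box_par (Box B) /\ w (Box B)) \/
  (exists g, In g families /\ k = fam_par g /\ forall t, locus E w t -> In t g).

Lemma colour_par E w p : In (Par p) sub -> (colour E w p <-> w (Par p)).
Proof.
  intros Hp; pose proof (pars_fresh p Hp); split.
  - intros [(q & _ & -> & H1)|[(B & _ & -> & _)|(g & _ & -> & _)]]; auto;
      unfold box_par, fam_par in *; lia.
  - intros H1; left; eauto.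
Qed.

Lemma colour_box E w B :
  In (Box B) sub -> (colour E w (box_par (Box B)) <-> w (Box B)).
Proof.
  intros HB; split; [|intros H; right; left; eauto].
  unfold box_par; intros [(q & Hq & E1 & _)|[(C & HC & E1 & H1)|(g & _ & E1 & _)]].
  - apply pars_fresh in Hq; lia.
  - unfold box_par in E1.
    replace (Box B) with (Box C); [exact H1|]; apply (pos_inj sub); auto; lia.
  - unfold fam_par in E1; lia.
Qed.

Lemma colour_fam E w g :
  In g families -> (colour E w (fam_par g) <-> forall t, locus E w t -> In t g).
Proof.
  intros Hg; split; [|intros H; right; right; eauto].
  unfold fam_par; intros [(q & Hq & E1 & _)|[(C & _ & E1 & _)|(h & Hh & E1 & H1)]].
  - apply pars_fresh in Hq; lia.
  - unfold box_par in E1; lia.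
  - unfold fam_par in E1.
    replace g with h; [exact H1|]; apply (pos_inj families); auto; lia.
Qed.

Lemma colour_all_pars E w k : colour E w k -> In k all_pars.
Proof.
  unfold all_pars; rewrite !in_app_iff, !in_map_iff.
  intros [(p & Hp & -> & _)|[(B & HB & -> & _)|(g & Hg & -> & _)]].
  - left; now apply in_pars.
  - right; left; exists (Box B); split; [reflexivity|apply in_filt; eauto].
  - right; right; eauto.
Qed.

Lemma in_all_pars_par p : In (Par p) sub -> In p all_pars.
Proof. intros H; apply in_or_app; left; now apply in_pars. Qed.

Lemma in_all_pars_box B : In (Box B) sub -> In (box_par (Box B)) all_pars.
Proof.
  intros H; apply in_or_app; right; apply in_or_app; left.
  apply in_map, in_filt; eauto.
Qed.

Lemma in_all_pars_fam g : In g families -> In (fam_par g) all_pars.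
Proof.
  intros H; apply in_or_app; right; apply in_or_app; right; now apply in_map.
Qed.

(* The truth set of a new root with colour [c] and variables [a], placed below
   points whose truth sets form the set [S]. *)
Fixpoint ext (c a : nat -> Prop) (S : list form -> Prop) (C : form) : Prop :=
  match C with
  | Var x => a x
  | Par p => c p
  | Bot => False
  | And B D => ext c a S B /\ ext c a S D
  | Or B D => ext c a S B \/ ext c a S D
  | Imp B D => (forall t, S t -> In (Imp B D) t) /\ (ext c a S B -> ext c a S D)
  | Box B => c (box_par (Box B))
  end.

(** What projectivity leaves visible in a colour: the least announced family accepts a new root of
    colour [c] below any of its subsets. No source world occurs, so the condition can be expressed
    by a formula over [all_pars]. *)
Definition good (c : nat -> Prop) : Prop :=
  exists g, In g families /\ c (fam_par g) /\
    (forall h, In h families -> c (fam_par h) -> incl g h) /\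
    forall S, (forall t, S t -> In t g) ->
      exists a, In a (sublists vars) /\
        (forall t, S t -> forall x, In x a -> In (Var x) t) /\
        In (filt (ext c (fun x => In x a) S) sub) g.

(** Projectivity is used here. A root is placed below all theories of the locus whose truth sets lie
    in [S], and is then read through the projective substitution [th], which restores [E]. *)
Lemma locus_root E w S : Gamma_H E -> prime iGL w -> w E ->
  (forall t, S t -> locus E w t) ->
  exists a, In a (sublists vars) /\
    (forall t, S t -> forall x, In x a -> In (Var x) t) /\
    locus E w (filt (ext (colour E w) (fun x => In x a) S) sub).
Proof.
  intros [_ (th & F & HF & HEF & Hth)] Hw HwE HS.
  set (Fm := fun m => prime iGL m /\ m E /\
                (forall X, S_NNILbox X -> w X -> m X) /\ S (filt m sub)).
  assert (H1 : forall m, Fm m -> prime iGL m) by (intros m Hm; apply Hm).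
  assert (H2 : forall m, Fm m -> forall X, S_NNILbox X -> w X -> m X)
    by (intros m Hm; apply Hm).
  pose proof (root_prime w Fm Hw H1 H2) as Hr.
  pose proof (root_sub w Fm H1 H2) as Hrs.
  set (r := root w Fm) in *.
  assert (Hr' : prime iGL (fun C => r (app_osubst th C))).
  { split.
    - intros A HA; now apply (prime_base _ _ Hr), iGL_osubst.
    - intros A HA; now apply (prime_base _ _ Hr), iGL_osubst, iGL_closed.
    - intros A B; apply (prime_mp _ _ Hr).
    - intros A B; apply (prime_or _ _ Hr).
    - apply (prime_bot _ _ Hr). }
  (* [w] contains [E], hence [app_osubst th E], hence [F]. The S-NNIL(box) formula [F] survives at
     the root and gives [app_osubst th E] back. *)
  assert (HrE : r (app_osubst th E)).
  { assert (Hi : forall v, prime iGL v -> (v (app_osubst th E) <-> v F)).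
    { intros v Hv; pose proof (prime_base _ _ Hv _ HEF) as Hi.
      apply (prime_And _ _ _ _ Hv) in Hi as [Hi1 Hi2].
      split; apply (prime_mp _ _ Hv); assumption. }
    apply (Hi _ Hr), (root_SN w Fm Hw H1 H2 F HF), (Hi _ Hw).
    now apply (prime_osubst_iff E th w E Hth Hw HwE). }
  (* The new variables are those whose projective images hold at the root. *)
  exists (filt (fun x => r (th x)) vars).
  split; [apply filt_sublists|split].
  - intros t Ht x Hx; apply in_filt in Hx as [Hx Hxr]; apply in_vars in Hx.
    destruct (HS t Ht) as (m & Hm1 & Hm2 & Hm3 & ->).
    assert (Hm : Fm m) by exact (conj Hm1 (conj Hm2 (conj Hm3 Ht))).
    apply in_filt; split; [exact Hx|].
    apply (prime_osubst_iff E th m (Var x) Hth Hm1 Hm2), (Hrs m _ Hm), Hxr.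
  - exists (fun C => r (app_osubst th C)); split; [exact Hr'|split; [exact HrE|split]].
    + intros X HX HwX; rewrite (L0_parb_osubst th X (proj2 (proj2 HX))).
      now apply (root_SN w Fm Hw H1 H2).
    + apply filt_ext; intros C; induction C; intros HC; pose proof (Hsub _ HC) as Hc;
        cbn [ext app_osubst].
      * rewrite in_filt, in_vars; tauto.
      * exact (colour_par E w n HC).
      * tauto.
      * destruct Hc as [Hc1 Hc2]; rewrite (IHC1 Hc1), (IHC2 Hc2).
        apply (prime_And _ _ _ _ Hr).
      * destruct Hc as [Hc1 Hc2]; rewrite (IHC1 Hc1), (IHC2 Hc2).
        apply (prime_Or _ _ _ _ Hr).
      * destruct Hc as [Hc1 Hc2]; rewrite (IHC1 Hc1), (IHC2 Hc2).
        change (r (Imp (app_osubst th C1) (app_osubst th C2))) with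
          ((forall m, Fm m -> m (app_osubst th (Imp C1 C2))) /\
           (r (app_osubst th C1) -> r (app_osubst th C2))).
        apply and_iff_compat_r; split.
        -- intros H m Hm; destruct Hm as (Hm1 & Hm2 & Hm3 & Hm4).
           apply (prime_osubst_iff E th m _ Hth Hm1 Hm2).
           apply H, in_filt in Hm4; tauto.
        -- intros H t Ht; destruct (HS t Ht) as (m & Hm1 & Hm2 & Hm3 & ->).
           assert (Hm : Fm m) by exact (conj Hm1 (conj Hm2 (conj Hm3 Ht))).
           apply in_filt; split; [exact HC|].
           apply (prime_osubst_iff E th m _ Hth Hm1 Hm2), H, Hm.
      * exact (colour_box E w C HC).
Qed.

Lemma locus_self E w : prime iGL w -> w E -> locus E w (filt w sub).
Proof. intros Hw HE; exists w; auto. Qed.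

Lemma locus_sublists E w t : locus E w t -> In t (sublists sub).
Proof. intros (m & _ & _ & _ & ->); apply filt_sublists. Qed.

(** The least announced family is the locus itself, listed as a sublist. *)
Lemma good_colour E w : Gamma_H E -> prime iGL w -> w E -> good (colour E w).
Proof.
  intros HE Hw HwE.
  assert (Hg : forall t, In t (filt (locus E w) (sublists sub)) <-> locus E w t).
  { intros t; rewrite in_filt; split; [tauto|intros H; split; auto].
    eapply locus_sublists; eauto. }
  exists (filt (locus E w) (sublists sub)).
  assert (HF : In (filt (locus E w) (sublists sub)) families) by apply filt_sublists.
  split; [exact HF|split; [|split]].
  - apply colour_fam; [exact HF|]; intros t; apply Hg.
  - intros h Hh Hc t Ht; apply Hg in Ht; apply (colour_fam E w h Hh); assumption.
  - intros S HS; destruct (locus_root E w S HE Hw HwE) as (a & H1 & H2 & H3).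
    + intros t Ht; apply Hg, HS, Ht.
    + exists a; split; [exact H1|split; [exact H2|now apply Hg]].
Qed.

(* The finitely many preservativity consequences that a source world must satisfy. *)
Definition Pstar : form :=
  bigand Top (flat_map (fun g =>
    map (Imp (Box (chi (fun C => C) sub g)))
        (filt (fun B => iGLH (Imp (Box (chi (fun C => C) sub g)) B)) boxes)) families).

Lemma iGLH_Pstar : iGLH Pstar.
Proof.
  apply (prime_complete0 _ _ iGLH_closed); intros v Hv.
  apply (prime_bigand _ _ _ _ Hv (prime_Top _ _ Hv)); intros A HA.
  apply in_flat_map in HA as (g & _ & HA); apply in_map_iff in HA as (B & <- & HB).
  apply in_filt in HB; now apply (prime_base _ _ Hv).
Qed.

Lemma Pstar_mp v g D : prime iGL v -> v Pstar -> In g families -> In (Box D) sub ->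
  iGLH (Imp (Box (chi (fun C => C) sub g)) (Box D)) ->
  v (Box (chi (fun C => C) sub g)) -> v (Box D).
Proof.
  intros Hv HP Hg HD H; apply (prime_mp _ _ Hv).
  refine (proj1 (prime_bigand _ _ _ _ Hv (prime_Top _ _ Hv)) HP _ _).
  apply in_flat_map; exists g; split; [exact Hg|].
  apply in_map, in_filt; split; [apply in_filt; eauto|exact H].
Qed.

(** Modal accessibility between source pairs, restricted to finite data. Bodies of boxes must hold
    on the whole locus of the successor, since that is what [gamma_sound] consumes. *)
Definition succ (E : form) (w : form -> Prop) (E' : form) (w' : form -> Prop) : Prop :=
  Gamma_H E' /\ prime iGL w' /\ w' E' /\ w' Pstar /\
  (forall t, locus E' w' t -> locus E w t) /\
  (forall C, In C sub -> parb C -> w C -> w' C) /\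
  (forall B, In (Box B) sub -> w (Box B) -> forall t, locus E' w' t -> In B t).

(** Preservativity boxes the conclusion. [Pstar] is a theorem of iGLH, so it drops out under the
    box, and the Löb axiom leaves [Box D]. *)
Lemma preserv_lob A D : In (Box D) sub ->
  preserv iGL Gamma_H A (Imp (Box D) (Imp Pstar D)) -> iGLH (Imp (Box A) (Box D)).
Proof.
  intros HD Hp; apply (prime_complete _ _ _ iGLH_closed); intros v Hv HA.
  pose proof (prime_weaken _ _ v iGLH_base Hv) as Hv'.
  apply (prime_box_lob v Hv').
  assert (HP : v (Box Pstar))
    by (apply (prime_base _ _ Hv), iGLH_necessitation, iGLH_Pstar).
  assert (HB := prime_mp _ _ Hv _ _ (prime_base _ _ Hv _ (iGLH_pres _ _ Hp)) HA).
  apply (prime_box_mp v Hv' Pstar); [|exact HP]; revert HB.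
  apply (prime_box_imp v Hv'), (prime_complete _ _ _ iGL_closed).
  intros u Hu H; apply (prime_Imp_iff _ _ _ _ Hu); intros u1 Hu1 L1 HP1.
  apply (prime_Imp_iff _ _ _ _ Hu1); intros u2 Hu2 L2 HD2.
  exact (prime_mp _ _ Hu2 _ _ (prime_mp _ _ Hu2 _ _ (L2 _ (L1 _ H)) HD2) (L2 _ HP1)).
Qed.

Lemma succ_exists E w D : Gamma_H E -> prime iGL w -> w E -> w Pstar ->
  In (Box D) sub -> ~ w (Box D) ->
  exists E' w', succ E w E' w' /\ w' (Box D) /\ ~ w' D.
Proof.
  intros HE Hw HwE HP HD HnD.
  (* The truth sets that points of a successor's locus may have. *)
  set (good_t := fun t => locus E w t /\
         (forall C, In C sub -> parb C -> w C -> In C t) /\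
         (forall B, In (Box B) sub -> w (Box B) -> In B t)).
  set (g := filt good_t (sublists sub)).
  assert (Hg : In g families) by apply filt_sublists.
  set (X := chi (fun C => C) sub g).
  (* Otherwise some [v] containing the bodies of all boxes of [w] refutes [X]. Yet every extension
     of [v] contains [E], which implies its box, and all S-NNIL(box) formulas of [w], so its truth
     set lies in [g]. *)
  assert (HX : w (Box X)).
  { apply NNPP; intros Hn.
    destruct (prime_box_extension w Hw _ Hn) as (v & Hv & Hwv & HvX).
    apply HvX, (prime_chi _ _ _ _ Hv); intros u Hu Hvu.
    assert (HSN : forall Y, S_NNILbox Y -> w Y -> u Y)
      by (intros Y HY H; apply Hvu, Hwv, prime_SN_box; assumption).
    apply in_filt; split; [apply filt_sublists|split; [|split]].
    - exists u; split; [exact Hu|split; [|split; [exact HSN|reflexivity]]].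
      apply Hvu, Hwv; destruct HE as [HC _].
      exact (prime_thm_mp w Hw _ _ HC HwE).
    - intros C HC Hpar H; apply in_filt; split; [exact HC|].
      apply HSN; [now apply SN_parb|exact H].
    - intros B HB H; apply in_filt; split; [exact (Hsub _ HB)|now apply Hvu, Hwv]. }
  (* Preservativity would yield an iGLH-theorem that [Pstar] imposes on [w], forcing [Box D]. *)
  assert (Hnp : ~ preserv iGL Gamma_H X (Imp (Box D) (Imp Pstar D))).
  { intros Hp; apply HnD, (Pstar_mp w g D); auto; now apply preserv_lob. }
  (* A counterexample to preservativity is the desired [E']. Since [E'] proves [X], every truth set
     in its locus is in [g]. *)
  apply NNPP; intros Hno; apply Hnp; intros E' HE' HEX.
  apply (prime_complete _ _ _ iGL_closed); intros v Hv HvE.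
  apply (prime_Imp_iff _ _ _ _ Hv); intros v1 Hv1 L1 HD1.
  apply (prime_Imp_iff _ _ _ _ Hv1); intros w' Hw' L2 HP2.
  apply NNPP; intros HnD'; apply Hno; exists E', w'.
  split; [|split; auto].
  assert (Hloc : forall t, locus E' w' t -> good_t t).
  { intros t (m & Hm & HmE & _ & ->).
    pose proof (prime_thm_mp m Hm _ _ HEX HmE) as HmX.
    apply (prime_chi _ _ _ _ Hm) with (v' := m) in HmX; auto.
    now apply in_filt in HmX. }
  assert (Hw'E : w' E') by auto.
  pose proof (Hloc _ (locus_self E' w' Hw' Hw'E)) as (_ & Hpar & _).
  split; [exact HE'|split; [exact Hw'|split; [exact Hw'E|split; [exact HP2|]]]].
  split; [|split].
  - intros t Ht; apply Hloc, Ht.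
  - intros C HC Hp H; specialize (Hpar C HC Hp H); now apply in_filt in Hpar.
  - intros B HB H t Ht; now apply (Hloc t Ht).
Qed.

End Source.

(** * The substitution *)

Section Iteration.
Context (sub : list form) (Hsub : sub_closed sub).

(** Only outermost boxes are replaced. The result is box-free, so [target] and the unifier do not
    refer to their own boxed instances; [links] ties the parameters to those later. *)
Fixpoint flat (C : form) : form :=
  match C with
  | And B D => And (flat B) (flat D)
  | Or B D => Or (flat B) (flat D)
  | Imp B D => Imp (flat B) (flat D)
  | Box B => Par (box_par sub (Box B))
  | _ => C
  end.

Definition target : form :=
  bigand Top (map (fun g => Imp (Par (fam_par sub g)) (chi flat sub g)) (families sub)).

(* Ghilardi's elementary substitutions for the formula [target]. *)
Definition toggle (a : list nat) (x : nat) : form :=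
  if excluded_middle_informative (In x a) then Imp target (Var x) else And target (Var x).

(** The head of the list is the latest step: it toggles the model already changed by [l']. *)
Fixpoint iterate (l : list (list nat)) : subst :=
  match l with
  | [] => Var
  | a :: l' => fun x => app_osubst (iterate l') (toggle a x)
  end.

Fixpoint passes (n : nat) : list (list nat) :=
  match n with
  | 0 => []
  | S n => sublists (vars sub) ++ passes n
  end.

(** The number of passes is one more than the largest possible value of [rank]. *)
Definition unifier : subst :=
  iterate (passes (S (length (all_pars sub)) * S (length (sublists sub)))).

Context {W : Type} (le : W -> W -> Prop) (val0 : W -> form -> Prop).
Hypothesis le_refl : forall w, le w w.
Hypothesis le_trans : forall u v w, le u v -> le v w -> le u w.
Hypothesis val0_mono : monotone le val0.

Definition col (w : W) (k : nat) : Prop := In k (all_pars sub) /\ val0 w (Par k).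

Hypothesis col_good : forall w, good sub (col w).

Fixpoint vl (l : list (list nat)) : W -> form -> Prop :=
  match l with
  | [] => val0
  | a :: l' => vsub le (vl l') (toggle a)
  end.

Lemma vl_iterate l w C : forces le (vl l) w C <-> forces le val0 w (app_osubst (iterate l) C).
Proof.
  rewrite <- forces_vsub; revert w C.
  assert (H : vl l = vsub le val0 (iterate l)); [|now rewrite H].
  induction l as [|a l IH]; simpl; extensionality w; extensionality C.
  - now destruct C.
  - destruct C; simpl; try (rewrite IH; reflexivity).
    apply propositional_extensionality; rewrite IH; apply forces_vsub.
Qed.

Lemma vl_mono l : monotone le (vl l).
Proof. induction l; simpl; auto using vsub_mono. Qed.

Lemma vl_Par l w k : vl l w (Par k) <-> val0 w (Par k).
Proof. induction l; simpl; tauto. Qed.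

Definition done (l : list (list nat)) (w : W) : Prop := forces le (vl l) w target.
Definition tr (l : list (list nat)) (w : W) : list form := truths le (vl l) flat sub w.

Lemma done_iff l w : done l w <->
  forall w', le w w' -> forall g, In g (families sub) ->
    val0 w' (Par (fam_par sub g)) -> In (tr l w') g.
Proof.
  unfold done, target; rewrite forces_bigand by apply forces_Top; split.
  - intros H w' Hw' g Hg Hv.
    specialize (H _ (in_map _ _ _ Hg) w' Hw'); cbn [forces] in H.
    rewrite vl_Par, forces_chi in H; exact (H Hv w' (le_refl w')).
  - intros H A HA; apply in_map_iff in HA as (g & <- & Hg).
    cbn [forces]; intros w' Hw' Hv; rewrite vl_Par in Hv.
    apply forces_chi; intros w'' Hw''; apply (H w''); auto.
    + eapply le_trans; eauto.
    + exact (val0_mono _ _ _ Hw'' Hv).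
Qed.

Lemma done_le l w w' : le w w' -> done l w -> done l w'.
Proof. apply forces_mono; auto using vl_mono. Qed.

(** Where [target] holds, both toggles are equivalent to the variable itself. *)
Lemma done_stable a l w C : done l w ->
  (forces le (vl (a :: l)) w C <-> forces le (vl l) w C).
Proof.
  revert w; induction C; intros w Hd; cbn [forces vl]; try (simpl; tauto).
  - simpl; unfold toggle; destruct (excluded_middle_informative (In n a)); cbn [forces].
    + split; [intros H; exact (H w (le_refl w) Hd)|].
      intros H w' Hw' _; exact (vl_mono l _ _ _ Hw' H).
    + unfold done in Hd; tauto.
  - rewrite <- (IHC1 w Hd), <- (IHC2 w Hd); reflexivity.
  - rewrite <- (IHC1 w Hd), <- (IHC2 w Hd); reflexivity.
  - split; intros H w' Hw'; specialize (H w' Hw'); pose proof (done_le _ _ _ Hw' Hd) as Hd';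
      specialize (IHC1 w' Hd'); specialize (IHC2 w' Hd'); cbn [vl] in *; tauto.
Qed.

Lemma tr_stable a l w : done l w -> tr (a :: l) w = tr l w.
Proof. intros H; apply filt_ext; intros C _; now apply done_stable. Qed.

Lemma done_cons a l w : done l w -> done (a :: l) w.
Proof.
  intros H; apply done_iff; intros w' Hw' g Hg Hv.
  rewrite tr_stable by (eapply done_le; eauto).
  exact (proj1 (done_iff l w) H w' Hw' g Hg Hv).
Qed.

Lemma done_app q l w : done l w -> done (q ++ l) w.
Proof. induction q; simpl; auto using done_cons. Qed.

(** Where [target] fails, the conjunctive toggle makes [x] false, and the implicative one makes it
    as true as the repaired points above permit. *)
Lemma undone_Var a l w x : ~ done l w ->
  (forces le (vl (a :: l)) w (Var x) <->
   In x a /\ forall w', le w w' -> done l w' -> forces le (vl l) w' (Var x)).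
Proof.
  intros Hn; cbn [forces vl vsub]; unfold toggle.
  destruct (excluded_middle_informative (In x a)); cbn [forces].
  - unfold done; cbn [forces]; tauto.
  - unfold done in Hn; tauto.
Qed.

(* The truth sets of the points above [w] that need no further repair. *)
Definition seen (l : list (list nat)) (w : W) (t : list form) : Prop :=
  exists w', le w w' /\ done l w' /\ tr l w' = t.

Lemma seen_le l w w' t : le w w' -> seen l w' t -> seen l w t.
Proof. intros H (v & Hv & Hd); exists v; eauto. Qed.

Lemma seen_cons a l w t : seen l w t -> seen (a :: l) w t.
Proof.
  intros (v & Hv & Hd & <-); exists v; split; [exact Hv|split].
  - now apply done_cons.
  - now apply tr_stable.
Qed.

Lemma seen_sublists l w t : seen l w t -> In t (sublists sub).
Proof. intros (v & _ & _ & <-); apply filt_sublists. Qed.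

Definition homogeneous (l : list (list nat)) (u : W) : Prop :=
  forall u', le u u' -> ~ done l u' -> col u' = col u /\ seen l u' = seen l u.

Definition new_truths (a : list nat) (l : list (list nat)) (u : W) : list form :=
  filt (ext sub (col u) (fun x => In x a /\ forall t, seen l u t -> In (Var x) t) (seen l u))
       sub.

(* All unrepaired points above a homogeneous one look alike, so after one step they
   behave like a single root placed below the repaired points. *)
Lemma homogeneous_tr a l u u' : homogeneous l u -> le u u' -> ~ done l u' ->
  tr (a :: l) u' = new_truths a l u.
Proof.
  intros Hh Hle Hnd; apply filt_ext; intros C; revert u' Hle Hnd.
  induction C; intros u' Hle Hnd HC; pose proof (Hsub _ HC) as Hc;
    destruct (Hh u' Hle Hnd) as [Hcol Hseen]; cbn [flat ext].
  - rewrite undone_Var by assumption; apply and_iff_compat_l; rewrite <- Hseen; split.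
    + intros H t (v & Hv & Hd & <-); apply in_filt; split; [exact HC|now apply H].
    + intros H v Hv Hd; assert (Ht : seen l u' (tr l v)) by (exists v; auto).
      apply H, in_filt in Ht; apply Ht.
  - rewrite <- Hcol; unfold col; cbn [forces]; rewrite vl_Par.
    pose proof (in_all_pars_par sub n HC); tauto.
  - simpl; tauto.
  - destruct Hc as [Hc1 Hc2]; cbn [forces].
    rewrite (IHC1 u' Hle Hnd Hc1), (IHC2 u' Hle Hnd Hc2); tauto.
  - destruct Hc as [Hc1 Hc2]; cbn [forces].
    rewrite (IHC1 u' Hle Hnd Hc1), (IHC2 u' Hle Hnd Hc2); tauto.
  - destruct Hc as [Hc1 Hc2]; cbn [forces]; split.
    + intros H; split.
      * rewrite <- Hseen; intros t (v & Hv & Hd & <-); apply in_filt; split; [exact HC|].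
        cbn [flat]; apply (done_stable a l v (Imp (flat C1) (flat C2)) Hd).
        intros v' Hv'; apply H; eapply le_trans; eauto.
      * rewrite <- (IHC1 u' Hle Hnd Hc1), <- (IHC2 u' Hle Hnd Hc2).
        apply H, le_refl.
    + intros [H1 H2] v Hv.
      destruct (classic (done l v)) as [Hd|Hd].
      * assert (Ht : seen l u (tr l v))
          by (exists v; split; [eapply le_trans; eauto|auto]).
        apply H1, in_filt in Ht; destruct Ht as [_ Ht]; cbn [flat] in Ht.
        apply (done_stable a l v _ Hd) in Ht; exact (Ht v (le_refl v)).
      * assert (Hle' : le u v) by (eapply le_trans; eauto).
        rewrite (IHC1 v Hle' Hd Hc1), (IHC2 v Hle' Hd Hc2); exact H2.
  - rewrite <- Hcol; unfold col; cbn [forces]; rewrite vl_Par.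
    pose proof (in_all_pars_box sub C HC); tauto.
Qed.

Definition admissible (a : list nat) (l : list (list nat)) (u : W) : Prop :=
  forall g, In g (families sub) -> col u (fam_par sub g) -> In (new_truths a l u) g.

Lemma homogeneous_repair a l u : homogeneous l u -> admissible a l u -> done (a :: l) u.
Proof.
  intros Hh Ha; apply done_iff; intros w Hw g Hg Hv.
  destruct (classic (done l w)) as [Hd|Hd].
  - rewrite tr_stable by exact Hd; exact (proj1 (done_iff l w) Hd w (le_refl w) g Hg Hv).
  - rewrite (homogeneous_tr a l u w Hh Hw Hd); apply Ha; [exact Hg|].
    rewrite <- (proj1 (Hh w Hw Hd)); split; [now apply in_all_pars_fam|exact Hv].
Qed.

(** A repaired point would have truth set [new_truths a l u] in every announced family, making [a]
    admissible. So a wrong guess repairs nothing, and the next one starts from the same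
    situation. *)
Lemma homogeneous_keep a l u : homogeneous l u -> ~ admissible a l u ->
  homogeneous (a :: l) u /\ seen (a :: l) u = seen l u.
Proof.
  intros Hh Ha.
  assert (Hnd : forall w, le u w -> done (a :: l) w -> done l w).
  { intros w Hw Hd; apply NNPP; intros Hnd; apply Ha; intros g Hg Hc.
    rewrite <- (homogeneous_tr a l u w Hh Hw Hnd).
    apply (proj1 (done_iff (a :: l) w) Hd w (le_refl w) g Hg).
    rewrite <- (proj1 (Hh w Hw Hnd)) in Hc; apply Hc. }
  assert (Hs : forall w, le u w -> seen (a :: l) w = seen l w).
  { intros w Hw; extensionality t; apply propositional_extensionality; split.
    - intros (v & Hv & Hd & <-).
      assert (Hd' := Hnd v (le_trans _ _ _ Hw Hv) Hd).
      exists v; rewrite tr_stable; auto.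
    - apply seen_cons. }
  split; [|exact (Hs u (le_refl u))].
  intros w Hw Hd; rewrite (Hs w Hw), (Hs u (le_refl u)).
  apply Hh; [exact Hw|]; intros Hd'; exact (Hd (done_cons a l w Hd')).
Qed.

(** Truth sets of repaired points above [u] lie in the least family announced at [u], so goodness of
    the colour supplies the variables of a root below them. *)
Lemma homogeneous_admissible l u : homogeneous l u ->
  exists a, In a (sublists (vars sub)) /\ admissible a l u.
Proof.
  intros Hh; destruct (col_good u) as (g & Hg & Hcg & Hmin & Hext).
  destruct (Hext (seen l u)) as (a & Ha & Hav & Hag).
  - intros t (v & Hv & Hd & <-).
    apply (proj1 (done_iff l v) Hd v (le_refl v) g Hg).
    exact (val0_mono _ _ _ Hv (proj2 Hcg)).
  - exists a; split; [exact Ha|]; intros h Hh' Hch.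
    apply (Hmin h Hh' Hch); unfold new_truths.
    replace (fun x => In x a /\ forall t, seen l u t -> In (Var x) t)
      with (fun x => In x a); [exact Hag|].
    extensionality x; apply propositional_extensionality; split; [|tauto].
    intros Hx; split; [exact Hx|]; intros t Ht; exact (Hav t Ht x Hx).
Qed.

Lemma homogeneous_pass q l u : homogeneous l u ->
  (exists a, In a q /\ admissible a l u) -> done (q ++ l) u.
Proof.
  intros Hh Hex.
  assert (H : forall q, (done (q ++ l) u) \/
    (homogeneous (q ++ l) u /\ seen (q ++ l) u = seen l u /\
     ~ exists a, In a q /\ admissible a l u)).
  { clear Hex q; induction q as [|a q IH]; simpl.
    - right; split; [exact Hh|split; [reflexivity|intros (a & [] & _)]].
    - destruct IH as [IH|(IH1 & IH2 & IH3)]; [left; now apply done_cons|].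
      assert (Hiff : admissible a (q ++ l) u <-> admissible a l u)
        by (unfold admissible, new_truths; rewrite IH2; reflexivity).
      destruct (classic (admissible a l u)) as [Ha|Ha].
      + left; apply homogeneous_repair; tauto.
      + right; destruct (homogeneous_keep a _ u IH1) as [H1 H2]; [tauto|].
        split; [exact H1|split; [congruence|]].
        intros (b & [<-|Hb] & Hb'); [tauto|eauto]. }
  destruct (H q) as [Hd|(_ & _ & Hn)]; [exact Hd|tauto].
Qed.

(** A lexicographic pair in one number: missing parameters, then truth sets seen. It never rises
    along [le] and never falls during the iteration. *)
Definition rank (l : list (list nat)) (u : W) : nat :=
  cnt (fun k => ~ col u k) (all_pars sub) * S (length (sublists sub)) +
  cnt (seen l u) (sublists sub).

Lemma rank_homogeneous l u :
  (forall u', le u u' -> ~ done l u' -> rank l u <= rank l u') -> homogeneous l u.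
Proof.
  intros H u' Hle Hd; specialize (H u' Hle Hd); unfold rank in H.
  assert (Hcol : forall k, col u k -> col u' k)
    by (intros k [H1 H2]; split; [exact H1|exact (val0_mono _ _ _ Hle H2)]).
  assert (Hseen : forall t, seen l u' t -> seen l u t) by eauto using seen_le.
  assert (I1 : forall k, In k (all_pars sub) -> ~ col u' k -> ~ col u k) by firstorder.
  assert (I2 : forall t, In t (sublists sub) -> seen l u' t -> seen l u t) by auto.
  pose proof (cnt_mono _ _ _ I1) as H1.
  pose proof (cnt_mono _ _ _ I2) as H2.
  pose proof (cnt_length (seen l u') (sublists sub)) as H3.
  assert (E1 : cnt (fun k => ~ col u k) (all_pars sub) <=
               cnt (fun k => ~ col u' k) (all_pars sub)) by nia.
  assert (E2 : cnt (seen l u) (sublists sub) <= cnt (seen l u') (sublists sub)) by nia.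
  split; extensionality t; apply propositional_extensionality; split; auto.
  - intros Ht; apply NNPP; intros Hn.
    exact (cnt_mono_eq _ _ _ I1 E1 t (proj1 Ht) Hn Ht).
  - intros Ht; apply (cnt_mono_eq _ _ _ I2 E2 t); auto.
    eapply seen_sublists; eauto.
Qed.

Lemma rank_mono a l u : rank l u <= rank (a :: l) u.
Proof.
  unfold rank; apply Nat.add_le_mono_l, cnt_mono; intros t _; apply seen_cons.
Qed.

Lemma rank_app q l u : rank l u <= rank (q ++ l) u.
Proof. induction q; simpl; [lia|]; etransitivity; [exact IHq|apply rank_mono]. Qed.

(** After [n] passes every undone point has rank at least [n]. One with rank exactly [n] is minimal
    among the undone points above it, hence homogeneous, and the next pass repairs it. *)
Lemma passes_rank n u : ~ done (passes n) u -> n <= rank (passes n) u.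
Proof.
  revert u; induction n as [|n IH]; intros u Hd; [lia|]; simpl in *.
  assert (Hd' : forall l w, ~ done (l ++ passes n) w -> ~ done (passes n) w)
    by (intros l w H1 H2; apply H1; now apply done_app).
  pose proof (IH u (Hd' _ u Hd)) as Hr.
  pose proof (rank_app (sublists (vars sub)) (passes n) u) as Hm.
  destruct (le_lt_dec (S n) (rank (passes n) u)) as [|Hlt]; [lia|exfalso].
  assert (Hh : homogeneous (passes n) u).
  { apply rank_homogeneous; intros u' _ Hu'; specialize (IH u' Hu'); lia. }
  apply Hd, homogeneous_pass; [exact Hh|].
  now apply homogeneous_admissible.
Qed.

Lemma unifier_truth w g C : In g (families sub) -> val0 w (Par (fam_par sub g)) ->
  (forall t, In t g -> In C t) -> forces le val0 w (app_osubst unifier (flat C)).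
Proof.
  intros Hg Hv HC; unfold unifier; rewrite <- vl_iterate.
  match goal with |- forces _ (vl (passes ?n)) _ _ => assert (Hd : done (passes n) w) end.
  { apply NNPP; intros Hn; apply passes_rank in Hn; unfold rank in Hn.
    pose proof (cnt_length (fun k => ~ col w k) (all_pars sub)).
    match type of Hn with context [cnt (seen ?l w) ?s] =>
      pose proof (cnt_length (seen l w) s) end.
    nia. }
  apply done_iff with (w' := w) (g := g), HC, in_filt in Hd; auto; tauto.
Qed.

End Iteration.

(** If [target] holds everywhere, every toggle is the identity. This keeps the unifier from
    disturbing the source model. *)
Lemma iterate_id sub {W} (le : W -> W -> Prop) val
    (le_refl : forall w, le w w) (le_trans : forall u v w, le u v -> le v w -> le u w)
    (Hm : monotone le val) l :
  (forall w, forces le val w (target sub)) ->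
  forall C w, forces le val w (app_osubst (iterate sub l) C) <-> forces le val w C.
Proof.
  intros Ht; induction l as [|a l IH]; intros C w.
  - replace (app_osubst (iterate sub []) C) with C; [reflexivity|].
    induction C; simpl in *; congruence.
  - rewrite <- forces_vsub.
    replace (vsub le val (iterate sub (a :: l))) with val; [reflexivity|].
    extensionality v; extensionality D; destruct D; try reflexivity.
    apply propositional_extensionality; cbn [vsub iterate]; rewrite IH.
    unfold toggle; destruct (excluded_middle_informative (In n a)); cbn [forces].
    + split; [intros H v' Hv' _; exact (Hm _ _ _ Hv' H)|].
      intros H; exact (H v (le_refl v) (Ht v)).
    + specialize (Ht v); tauto.
Qed.

(** * Derivability in the target logic *)

Lemma iGLHbox_closed : closed_logic iGLHbox.
Proof.
  split; [intros A HA; apply iGLHb_base, iGL_closed, HA|apply iGLHb_mp].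
Qed.

Lemma iGLHbox_necessitation A : iGLHbox A -> iGLHbox (Box A).
Proof.
  induction 1 as [A HA|A B H|A B H|A B _ IH1 _ IH2].
  - now apply iGLHb_base, iGL_necessitation.
  - now apply iGLHb_presb.
  - eapply iGLHb_mp; [apply iGLHb_base, iGL_ax, gl_k4, k4_4|now apply iGLHb_presb].
  - eapply iGLHb_mp; [eapply iGLHb_mp; [|exact IH1]|exact IH2].
    apply iGLHb_base, iGL_ax, gl_k4, k4_K.
Qed.

Definition entails (A B : form) : Prop := iGLHbox (Imp A B).

Lemma entails_intro A B : (forall v, prime iGLHbox v -> v A -> v B) -> entails A B.
Proof. apply (prime_complete _ _ _ iGLHbox_closed). Qed.

Lemma entails_elim A B v : entails A B -> prime iGLHbox v -> v A -> v B.
Proof. intros H Hv; apply (prime_mp _ _ Hv), (prime_base _ _ Hv), H. Qed.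

Lemma entails_trans A B C : entails A B -> entails B C -> entails A C.
Proof.
  intros H1 H2; apply entails_intro; intros v Hv HA.
  exact (entails_elim _ _ _ H2 Hv (entails_elim _ _ _ H1 Hv HA)).
Qed.

Lemma entails_thm A B : iGLHbox B -> entails A B.
Proof. intros H; apply entails_intro; intros v Hv _; now apply (prime_base _ _ Hv). Qed.

Lemma entails_mp A B C : entails A (Imp B C) -> entails A B -> entails A C.
Proof.
  intros H1 H2; apply entails_intro; intros v Hv HA.
  exact (prime_mp _ _ Hv _ _ (entails_elim _ _ _ H1 Hv HA) (entails_elim _ _ _ H2 Hv HA)).
Qed.

Lemma iGL_Top : iGL Top.
Proof. apply iGL_closed; apply ipc9. Qed.

Lemma SN_Box B : S_NNILbox (Box B).
Proof. apply SN_parb, parb_Box. Qed.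

(** A derivation uses finitely many preservativity axioms. Each, together with its box, is a member
    of [S_NNILbox], and so is their conjunction. *)
Lemma iGLHbox_finite A : iGLHbox A ->
  exists Q, S_NNILbox Q /\ iGLHbox Q /\ iGL (Imp Q A).
Proof.
  assert (HQ : forall B C, S_NNILbox (Boxdot (Imp (Box B) (Box C))))
    by (intros; apply SN_boxdot_Imp; apply lp_parb, parb_Box).
  assert (Hp : forall B C, preserv iGL S_NNILbox B C ->
                 iGLHbox (Boxdot (Imp (Box B) (Box C)))).
  { intros B C H; apply (prime_complete0 _ _ iGLHbox_closed); intros v Hv.
    apply (prime_And _ _ _ _ Hv); split; apply (prime_base _ _ Hv);
      [now apply iGLHb_pres|now apply iGLHb_presb]. }
  induction 1 as [A HA|A B H|A B H|A B _ (Q1 & H1 & H2 & H3) _ (Q2 & H4 & H5 & H6)].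
  - exists (Box Top); split; [apply SN_Box|split].
    + apply iGLHb_base, iGL_necessitation, iGL_Top.
    + apply (prime_complete _ _ _ iGL_closed); intros v Hv _; now apply (prime_base _ _ Hv).
  - exists (Boxdot (Imp (Box A) (Box B))); split; [apply HQ|split; [now apply Hp|]].
    apply iGL_closed; apply ipc3.
  - exists (Boxdot (Imp (Box A) (Box B))); split; [apply HQ|split; [now apply Hp|]].
    apply iGL_closed; apply ipc4.
  - exists (And Q1 Q2); split; [now apply SN_And|split].
    + apply (prime_complete0 _ _ iGLHbox_closed); intros v Hv.
      apply (prime_And _ _ _ _ Hv); split; now apply (prime_base _ _ Hv).
    + apply (prime_complete _ _ _ iGL_closed); intros v Hv HQ12.
      apply (prime_And _ _ _ _ Hv) in HQ12 as [HQ1 HQ2].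
      exact (prime_mp _ _ Hv _ _ (prime_thm_mp v Hv _ _ H3 HQ1)
               (prime_thm_mp v Hv _ _ H6 HQ2)).
Qed.

(** The axioms used in deriving [A] from [F] are joined to [F]; the resulting S-NNIL(box) premise
    brings preservativity over iGL into play. *)
Lemma preserv_entails F A B : S_NNILbox F -> preserv iGL S_NNILbox A B ->
  entails F A -> entails F B.
Proof.
  intros HF Hp HA; destruct (iGLHbox_finite _ HA) as (Q & HQ1 & HQ2 & HQ3).
  assert (H : iGL (Imp (And Q F) B)).
  { apply Hp; [now apply SN_And|].
    apply (prime_complete _ _ _ iGL_closed); intros v Hv H.
    apply (prime_And _ _ _ _ Hv) in H as [H1 H2].
    exact (prime_mp _ _ Hv _ _ (prime_thm_mp v Hv _ _ HQ3 H1) H2). }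
  apply entails_intro; intros v Hv HvF.
  apply (entails_elim _ _ _ (iGLHb_base _ H) Hv), (prime_And _ _ _ _ Hv).
  split; [now apply (prime_base _ _ Hv)|exact HvF].
Qed.

(** * Describing a source world by an S-NNIL(box) formula *)

Section Target.
Context (sub : list form) (Hsub : sub_closed sub).

Let gamma : subst := unifier sub.

(** Rules out the exact colour [c]: forcing all of [c] forces a parameter outside it. *)
Definition avoid (c : list nat) : form :=
  Imp (bigand (Box Top) (map Par c))
      (bigor (map Par (filt (fun k => ~ In k c) (all_pars sub)))).

Definition colours_good : form :=
  bigand (Box Top) (map (fun c => Boxdot (avoid c))
    (filt (fun c => ~ good sub (fun k => In k c)) (sublists (all_pars sub)))).

Definition links : form :=
  bigand (Box Top) (flat_map (fun B =>
    [Boxdot (Imp (Par (box_par sub B)) (app_subst gamma B));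
     Boxdot (Imp (app_subst gamma B) (Par (box_par sub B)))]) (boxes sub)).

Definition facts (E : form) (w : form -> Prop) : form :=
  bigand (Box Top) (map Par (filt (colour sub E w) (all_pars sub))).

(** Only [facts] depends on the world; the other two conjuncts are common to all descriptions. *)
Definition Phi (E : form) (w : form -> Prop) : form :=
  And colours_good (And links (facts E w)).

Lemma SN_Phi E w : S_NNILbox (Phi E w).
Proof.
  assert (HP : forall l A, In A (map Par l) -> parb A)
    by (intros l A HA; apply in_map_iff in HA as (k & <- & _); apply parb_Par).
  apply SN_And; [|apply SN_And]; (apply SN_bigand; [apply SN_Box|]); intros A HA.
  - apply in_map_iff in HA as (c & <- & _); apply SN_boxdot_Imp.
    + apply lattice_parb_bigand; [apply parb_Box|apply HP].
    + apply lattice_parb_bigor, HP.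
  - apply in_flat_map in HA as (B & HB & HA); apply in_filt in HB as [_ [C ->]].
    destruct HA as [<-|[<-|[]]]; apply SN_boxdot_Imp; apply lp_parb;
      try apply parb_Par; apply parb_Box.
  - apply in_map_iff in HA as (k & <- & _); apply SN_parb, parb_Par.
Qed.

Lemma prime_Box_Top v : prime iGLHbox v -> v (Box Top).
Proof.
  intros Hv; apply (prime_base _ _ Hv), iGLHb_base, iGL_necessitation, iGL_Top.
Qed.

Lemma prime_Phi v E w : prime iGLHbox v ->
  (v (Phi E w) <->
   v colours_good /\ v links /\ forall k, colour sub E w k -> v (Par k)).
Proof.
  intros Hv; unfold Phi; rewrite !(prime_And _ _ _ _ Hv).
  apply and_iff_compat_l, and_iff_compat_l; unfold facts.
  rewrite (prime_bigand _ _ _ _ Hv (prime_Box_Top _ Hv)); split.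
  - intros H k Hk; apply H, in_map, in_filt; split; [|exact Hk].
    eapply colour_all_pars; eauto.
  - intros H A HA; apply in_map_iff in HA as (k & <- & Hk); apply H.
    apply in_filt in Hk; tauto.
Qed.

Lemma Phi_mono E w E' w' : (forall k, colour sub E w k -> colour sub E' w' k) ->
  entails (Phi E' w') (Phi E w).
Proof.
  intros H; apply entails_intro; intros v Hv; rewrite !prime_Phi by exact Hv.
  intuition.
Qed.

Lemma prime_links v B : prime iGLHbox v -> v links -> In (Box B) sub ->
  v (Boxdot (Imp (Par (box_par sub (Box B))) (Box (app_subst gamma B)))) /\
  v (Boxdot (Imp (Box (app_subst gamma B)) (Par (box_par sub (Box B))))).
Proof.
  intros Hv HL HB.
  pose proof (proj1 (prime_bigand _ _ _ _ Hv (prime_Box_Top _ Hv)) HL) as H.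
  split; apply H, in_flat_map; exists (Box B);
    (split; [apply in_filt; eauto|simpl; auto]).
Qed.

Lemma forces_colours_good {W} (le : W -> W -> Prop) val w :
  (forall w, le w w) -> val w (Box Top) ->
  forces le val w colours_good -> good sub (col sub val w).
Proof.
  intros le_refl HT H; apply NNPP; intros Hn.
  set (c := filt (col sub val w) (all_pars sub)).
  assert (Hc : (fun k => In k c) = col sub val w).
  { extensionality k; apply propositional_extensionality; unfold c; rewrite in_filt.
    unfold col; tauto. }
  unfold colours_good in H; rewrite forces_bigand in H by exact HT.
  assert (Ha : forces le val w (Boxdot (avoid c))).
  { apply H; apply (in_map (fun c => Boxdot (avoid c))), in_filt.
    split; [apply filt_sublists|now rewrite Hc]. }
  destruct Ha as [Ha _].
  assert (Hk : forces le val w (bigor (map Par (filt (fun k => ~ In k c) (all_pars sub))))).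
  { apply (Ha w (le_refl w)), forces_bigand; [exact HT|]; intros A HA.
    apply in_map_iff in HA as (k & <- & Hk); apply in_filt in Hk.
    exact (proj2 (proj2 Hk)). }
  apply forces_bigor in Hk as (A & HA & HF).
  apply in_map_iff in HA as (k & <- & Hk); apply in_filt in Hk as [Hk1 Hk2].
  apply Hk2; change ((fun k => In k c) k); rewrite Hc; now split.
Qed.

Lemma forces_gamma_flat {W} (le : W -> W -> Prop) val :
  (forall w B, In (Box B) sub ->
     (val w (Par (box_par sub (Box B))) <-> val w (Box (app_subst gamma B)))) ->
  forall C w, In C sub ->
    (forces le val w (app_subst gamma C) <->
     forces le val w (app_osubst gamma (flat sub C))).
Proof.
  intros HL C; induction C; intros w HC; pose proof (Hsub _ HC) as Hc;
    cbn [app_subst app_osubst flat forces]; try tauto.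
  - rewrite (IHC1 w (proj1 Hc)), (IHC2 w (proj2 Hc)); tauto.
  - rewrite (IHC1 w (proj1 Hc)), (IHC2 w (proj2 Hc)); tauto.
  - destruct Hc as [Hc1 Hc2]; split; intros H w' Hw'; specialize (H w' Hw');
      rewrite (IHC1 w' Hc1), (IHC2 w' Hc2) in *; exact H.
  - symmetry; apply HL, HC.
Qed.

(** In the canonical model above a theory with [Phi E w], all colours are good and box parameters
    agree with the boxes they name. The locus is an announced family, so the unifier keeps the truth
    set inside it. *)
Lemma gamma_sound E w D : In D sub -> (forall t, locus sub E w t -> In D t) ->
  entails (Phi E w) (app_subst gamma D).
Proof.
  intros HD Hloc; apply entails_intro; intros u Hu HuP.
  set (u0 := exist _ u (conj Hu (fun A HA => HA)) : cone iGLHbox u).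
  set (val := fun v : cone iGLHbox u => proj1_sig v).
  assert (Hp : forall v : cone iGLHbox u, prime iGLHbox (proj1_sig v)
            /\ proj1_sig v (Phi E w))
    by (intros [v [H1 H2]]; split; [exact H1|now apply H2]).
  assert (Hgood : forall v, good sub (col sub val v)).
  { intros v; destruct (Hp v) as [H1 H2]; apply (prime_Phi _ _ _ H1) in H2.
    apply (forces_colours_good cone_le); [apply cone_refl|now apply prime_Box_Top|].
    apply cone_forces; tauto. }
  set (g := filt (locus sub E w) (sublists sub)).
  assert (Hg : In g (families sub)) by apply filt_sublists.
  change (proj1_sig u0 (app_subst gamma D)); apply cone_forces.
  apply (forces_gamma_flat cone_le val); [|exact HD|].
  - intros v B HB; destruct (Hp v) as [H1 H2]; apply (prime_Phi _ _ _ H1) in H2.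
    destruct (prime_links _ B H1 (proj1 (proj2 H2)) HB) as [H3 H4].
    apply (prime_And _ _ _ _ H1) in H3 as [H3 _], H4 as [H4 _].
    split; apply (prime_mp _ _ H1); assumption.
  - apply (unifier_truth sub Hsub cone_le val cone_refl cone_trans) with (g := g); auto.
    + intros v v' A H; apply H.
    + destruct (Hp u0) as [H1 H2]; apply (prime_Phi _ _ _ H1) in H2.
      apply H2, colour_fam; [exact Hg|]; intros t Ht; apply in_filt; split; [|exact Ht].
      eapply locus_sublists; eauto.
    + intros t Ht; apply in_filt in Ht; apply Hloc; tauto.
Qed.

Lemma locus_mono E w w' t :
  (forall A, w A -> w' A) -> locus sub E w' t -> locus sub E w t.
Proof.
  intros H (m & H1 & H2 & H3 & H4); exists m.
  split; [exact H1|split; [exact H2|split; [|exact H4]]].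
  intros X HX HwX; exact (H3 X HX (H X HwX)).
Qed.

(** A larger theory has a smaller locus and therefore announces more families. *)
Lemma colour_mono E w w' k :
  (forall A, w A -> w' A) -> colour sub E w k -> colour sub E w' k.
Proof.
  intros H [(p & H1 & H2 & H3)|[(B & H1 & H2 & H3)|(g & H1 & H2 & H3)]].
  - left; eauto.
  - right; left; eauto.
  - right; right; exists g; split; [exact H1|split; [exact H2|]].
    intros t Ht; apply H3; eapply locus_mono; eauto.
Qed.

Lemma succ_colour E w E' w' k :
  succ sub E w E' w' -> colour sub E w k -> colour sub E' w' k.
Proof.
  intros (_ & _ & _ & _ & H4 & H5 & _) [(p & H1 & H2 & H3)|[(B & H1 & H2 & H3)|(g & H1 & H2 & H3)]].
  - left; exists p; split; [exact H1|split; [exact H2|]].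
    exact (H5 _ H1 (parb_Par p) H3).
  - right; left; exists B; split; [exact H1|split; [exact H2|]].
    exact (H5 _ H1 (parb_Box B) H3).
  - right; right; exists g; auto.
Qed.

Lemma succ_mono E w v E' w' : (forall A, w A -> v A) ->
  succ sub E v E' w' -> succ sub E w E' w'.
Proof.
  intros H (H1 & H2 & H3 & H4 & H5 & H6 & H7).
  split; [exact H1|split; [exact H2|split; [exact H3|split; [exact H4|split; [|split]]]]].
  - intros t Ht; apply (locus_mono E w v); auto.
  - intros C HC Hp Hw; apply H6; auto.
  - intros B HB Hw; apply H7; auto.
Qed.

(** * The model over a source world *)

Section World.
Context (E : form) (w : form -> Prop).
Hypothesis HE : Gamma_H E.
Hypothesis Hw : prime iGL w.
Hypothesis HwE : w E.

(* A box holds when it follows from [Phi] here and its body follows from [Phi] at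
   every successor; requiring both makes the 4 and Loeb axioms true. *)
Definition box_val (v : form -> Prop) (X : form) : Prop :=
  entails (Phi E v) (Box X) /\
  forall E' w', succ sub E v E' w' -> entails (Phi E' w') X.

Definition world_val (v : cone iGL w) (A : form) : Prop :=
  match A with
  | Var x => proj1_sig v (Var x)
  | Par k => colour sub E (proj1_sig v) k
  | Box X => box_val (proj1_sig v) X
  | _ => False
  end.

Lemma world_prime (v : cone iGL w) : prime iGL (proj1_sig v).
Proof. apply (proj2_sig v). Qed.

Lemma world_E (v : cone iGL w) : proj1_sig v E.
Proof. now apply (proj2_sig v). Qed.

Lemma world_mono : monotone cone_le world_val.
Proof.
  intros v v' [] Hle; cbn [world_val]; auto.
  - apply colour_mono, Hle.
  - intros [H1 H2]; split.
    + eapply entails_trans; [|exact H1].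
      apply Phi_mono; intros k; apply colour_mono, Hle.
    + intros E' w' Hs; apply H2; eapply succ_mono; eauto.
Qed.

Lemma succ_Phi v E' w' X : succ sub E v E' w' ->
  entails (Phi E v) X -> entails (Phi E' w') X.
Proof.
  intros Hs; apply entails_trans, Phi_mono; intros k; now apply succ_colour.
Qed.

Lemma box_val_thm v X : iGLHbox X -> box_val v X.
Proof.
  intros H; split; [now apply entails_thm, iGLHbox_necessitation|].
  intros; now apply entails_thm.
Qed.

Lemma entails_iGL A B C : iGL (Imp B C) -> entails A B -> entails A C.
Proof. intros H; apply entails_mp, entails_thm, iGLHb_base, H. Qed.

Lemma world_iGL A : iGL A -> forall v, forces cone_le world_val v A.
Proof.
  assert (Hk4 : forall B, ax_iK4 B -> iGL B) by (intros; now apply iGL_ax, gl_k4).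
  induction 1 as [A HA|A HA|A B _ IH1 _ IH2]; intros v.
  - destruct HA as [A HA|A]; [destruct HA as [A HA|A B|A|p]|].
    + apply (forces_ipc _ cone_refl cone_trans _ _ _ world_mono HA).
    + intros v1 _ [H1 H2] v2 L [H3 H4].
      destruct (world_mono v1 v2 (Box (Imp A B)) L (conj H1 H2)) as [H5 H6].
      split.
      * eapply entails_mp; [|exact H3]; revert H5; apply entails_iGL, Hk4, k4_K.
      * intros E' w' Hs; exact (entails_mp _ _ _ (H6 _ _ Hs) (H4 _ _ Hs)).
    + intros v1 _ [H1 H2]; split.
      * revert H1; apply entails_iGL, Hk4, k4_4.
      * intros E' w' Hs; exact (succ_Phi _ _ _ _ Hs H1).
    + intros v1 _ Hp; cbn [forces world_val] in *.
      assert (Hpar : forall E v, colour sub E v p -> entails (Phi E v) (Par p)).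
      { intros E0 v0 H; apply entails_intro; intros u Hu H1.
        apply (prime_Phi _ _ _ Hu) in H1; now apply H1. }
      split; [|intros E' w' Hs; now apply Hpar, (succ_colour _ _ _ _ _ Hs)].
      eapply entails_iGL; [apply Hk4, k4_par|now apply Hpar].
    + intros v1 _ [H1 H2].
      (* The Löb axiom is applied inside the logic; the resulting box passes to the successors'
         descriptions and discharges the premise there. *)
      assert (H3 : entails (Phi E (proj1_sig v1)) (Box A))
        by (revert H1; apply entails_iGL, iGL_ax, gl_lob).
      split; [exact H3|]; intros E' w' Hs.
      exact (entails_mp _ _ _ (H2 _ _ Hs) (succ_Phi _ _ _ _ Hs H3)).
  - apply box_val_thm, iGLHb_base, iGL_ax, HA.
  - exact (IH1 v v (cone_refl v) (IH2 v)).
Qed.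

(** Every successor is described by a member of [S_NNILbox], so preservativity applies to it. *)
Lemma world_iGLHbox A : iGLHbox A -> forall v, forces cone_le world_val v A.
Proof.
  induction 1 as [A HA|A B H|A B H|A B _ IH1 _ IH2]; intros v.
  - now apply world_iGL.
  - intros v1 _ [H1 H2]; split.
    + exact (entails_mp _ _ _ (entails_thm _ _ (iGLHb_pres _ _ H)) H1).
    + intros E' w' Hs; apply (preserv_entails _ A B); [apply SN_Phi|exact H|].
      now apply H2.
  - now apply box_val_thm, iGLHb_pres.
  - exact (IH1 v v (cone_refl v) (IH2 v)).
Qed.

(** Consequences of the common conjuncts follow from every [Phi], here and at all successors. *)
Lemma box_val_const v Y :
  (forall u, prime iGLHbox u -> u colours_good -> u links -> u (Boxdot Y)) ->
  box_val v Y.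
Proof.
  intros H.
  assert (HY : forall E v, entails (Phi E v) (Boxdot Y)).
  { intros E0 v0; apply entails_intro; intros u Hu HP.
    apply (prime_Phi _ _ _ Hu) in HP; apply H; tauto. }
  split.
  - eapply entails_iGL; [|apply HY]; apply iGL_closed, ipc4.
  - intros E' w' _; eapply entails_iGL; [|apply HY]; apply iGL_closed, ipc3.
Qed.

Lemma world_flat C : In C sub -> forall v,
  (forces cone_le world_val v (flat sub C) <-> proj1_sig v C).
Proof.
  induction C; intros HC v; pose proof (Hsub _ HC) as Hc;
    cbn [flat forces world_val].
  - tauto.
  - now apply colour_par.
  - pose proof (prime_bot _ _ (world_prime v)); tauto.
  - rewrite (IHC1 (proj1 Hc)), (IHC2 (proj2 Hc)), (prime_And _ _ _ _ (world_prime v)); tauto.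
  - rewrite (IHC1 (proj1 Hc)), (IHC2 (proj2 Hc)), (prime_Or _ _ _ _ (world_prime v)); tauto.
  - rewrite cone_Imp; split; intros H v' Hv'; specialize (H v' Hv');
      rewrite (IHC1 (proj1 Hc)), (IHC2 (proj2 Hc)) in *; exact H.
  - now apply colour_box.
Qed.

(** Each point's truth set is in its own locus, hence in every family it announces: the source model
    needs no repair. *)
Lemma world_target v : forces cone_le world_val v (target sub).
Proof.
  unfold target; apply forces_bigand; [apply forces_Top|]; intros A HA.
  apply in_map_iff in HA as (g & <- & Hg).
  intros v1 _ Hc; apply forces_chi; intros v2 L.
  apply (world_mono _ _ (Par _) L) in Hc; cbn [world_val] in Hc.
  pose proof (proj1 (colour_fam sub E _ g Hg) Hc) as Hc'.
  replace (truths _ _ _ _ _) with (filt (proj1_sig v2) sub).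
  - apply Hc', locus_self; [apply world_prime|apply world_E].
  - apply filt_ext; intros C HC; symmetry; now apply world_flat.
Qed.

Lemma world_Box_Top v : world_val v (Box Top).
Proof. apply box_val_thm, iGLHb_base, iGL_Top. Qed.

Lemma world_colours_good v : forces cone_le world_val v colours_good.
Proof.
  apply forces_bigand; [apply world_Box_Top|]; intros A HA.
  pose proof HA as HA'; apply in_map_iff in HA as (c & <- & Hc).
  apply in_filt in Hc as [Hc Hbad]; apply sublists_incl in Hc.
  split.
  - intros v1 _ Hl; apply NNPP; intros Hn; apply Hbad.
    replace (fun k => In k c) with (colour sub E (proj1_sig v1)).
    { now apply (good_colour sub Hsub); [|apply world_prime|apply world_E]. }
    rewrite forces_bigand in Hl by apply world_Box_Top.
    extensionality k; apply propositional_extensionality; split; intros Hk.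
    + apply NNPP; intros Hkc; apply Hn, forces_bigor; exists (Par k); split; [|exact Hk].
      apply in_map, in_filt; split; [eapply colour_all_pars; eauto|exact Hkc].
    + exact (Hl _ (in_map _ _ _ Hk)).
  - apply box_val_const; intros u Hu H1 _.
    exact (proj1 (prime_bigand _ _ _ _ Hu (prime_Box_Top _ Hu)) H1 _ HA').
Qed.

Hypothesis Hrefute : forall (v : cone iGL w) B, In (Box B) sub ->
  ~ proj1_sig v (Box B) -> ~ box_val (proj1_sig v) (app_subst gamma B).

(** A box of the source theory holds by [links] here and by [gamma_sound] at successors; a failed
    one is refuted by [Hrefute]. *)
Lemma world_box (v : cone iGL w) B : In (Box B) sub ->
  (colour sub E (proj1_sig v) (box_par sub (Box B)) <->
   box_val (proj1_sig v) (app_subst gamma B)).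
Proof.
  intros HB; rewrite colour_box by exact HB; split.
  - intros H; split.
    + apply entails_intro; intros u Hu HP; apply (prime_Phi _ _ _ Hu) in HP.
      destruct HP as (_ & HL & HP).
      destruct (prime_links u B Hu HL HB) as [H1 _].
      apply (prime_And _ _ _ _ Hu) in H1 as [H1 _].
      apply (prime_mp _ _ Hu _ _ H1), HP; now apply colour_box.
    + intros E' w' (_ & _ & _ & _ & _ & _ & H7); apply gamma_sound; [exact (Hsub _ HB)|].
      now apply H7.
  - intros H; apply NNPP; intros Hn; exact (Hrefute v B HB Hn H).
Qed.

Lemma world_links v : forces cone_le world_val v links.
Proof.
  apply forces_bigand; [apply world_Box_Top|]; intros A HA.
  pose proof HA as HA'; apply in_flat_map in HA as (B & HB & HA).
  apply in_filt in HB as [HB [C ->]].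
  assert (Hbox : forall Y, In (Boxdot Y) (flat_map (fun B =>
      [Boxdot (Imp (Par (box_par sub B)) (app_subst gamma B));
       Boxdot (Imp (app_subst gamma B) (Par (box_par sub B)))]) (boxes sub)) ->
      box_val (proj1_sig v) Y).
  { intros Y HY; apply box_val_const; intros u Hu _ H1.
    exact (proj1 (prime_bigand _ _ _ _ Hu (prime_Box_Top _ Hu)) H1 _ HY). }
  destruct HA as [<-|[<-|[]]]; (split; [|exact (Hbox _ HA')]);
    intros v1 _; cbn [app_subst forces world_val]; now apply world_box.
Qed.

(** The model at [w] forces [Phi E w]. If it forced the image of [D], then by the links it would
    force the outer image of [flat sub D]; the unifier acts as the identity there, so [D] would be
    in [w]. *)
Lemma world_refutes D : In D sub -> ~ w D -> ~ entails (Phi E w) (app_subst gamma D).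
Proof.
  intros HD HnD H; apply HnD.
  set (w0 := exist _ w (conj Hw (fun A HA => HA)) : cone iGL w).
  change (proj1_sig w0 D); apply world_flat; [exact HD|].
  apply (iterate_id sub cone_le world_val cone_refl cone_trans world_mono
           (passes sub (S (length (all_pars sub)) * S (length (sublists sub))))
           world_target).
  apply (forces_gamma_flat cone_le world_val (fun v B HB => world_box v B HB) D w0 HD).
  apply (world_iGLHbox _ H w0 w0 (cone_refl w0)).
  split; [apply world_colours_good|split; [apply world_links|]].
  apply forces_bigand; [apply world_Box_Top|]; intros A HA.
  apply in_map_iff in HA as (k & <- & Hk); apply in_filt in Hk; apply Hk.
Qed.

End World.

(** Induction on the number of failed boxes. The successor refuting [B] retains the boxes of [w]
    from [sub] and also contains [Box B], so its number is strictly smaller. *)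
Lemma Phi_refutes n E w D : Gamma_H E -> prime iGL w -> w E -> w (Pstar sub) ->
  cnt (fun B => ~ w B) (boxes sub) < n ->
  In D sub -> ~ w D -> ~ entails (Phi E w) (app_subst gamma D).
Proof.
  revert E w D; induction n as [|n IH]; intros E w D HE Hw HwE HwP Hn; [lia|].
  apply world_refutes; try assumption.
  intros v B HB HnB [_ H].
  pose proof (world_prime w v) as Hv; pose proof (world_E E w HwE v) as HvE.
  assert (Hwv : forall A, w A -> proj1_sig v A) by apply (proj2_sig v).
  destruct (succ_exists sub Hsub E (proj1_sig v) B) as (E' & w' & Hs & HB1 & HB2); auto.
  pose proof Hs as (H1 & H2 & H3 & H4 & H5 & H6 & H7).
  apply (IH E' w' B H1 H2 H3 H4); [|exact (Hsub _ HB)|exact HB2|now apply H].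
  assert (HBb : In (Box B) (boxes sub)) by (apply in_filt; eauto).
  assert (Hle : forall C, In C (boxes sub) -> ~ w' C -> ~ w C).
  { intros C HC HnC HwC; apply in_filt in HC as [HC [C' ->]].
    apply HnC, H6; [exact HC|apply parb_Box|now apply Hwv]. }
  pose proof (cnt_mono _ _ _ Hle) as Hc.
  destruct (le_lt_dec n (cnt (fun C => ~ w' C) (boxes sub))) as [Hlt|]; [|assumption].
  exfalso; apply (cnt_mono_eq _ _ _ Hle ltac:(lia) (Box B) HBb); [|exact HB1].
  intros HwB; apply HnB, Hwv, HwB.
Qed.

End Target.

(** * Subformula closure and the conclusion *)

Fixpoint subforms (A : form) : list form :=
  A :: match A with
       | And B C | Or B C | Imp B C => subforms B ++ subforms C
       | Box B => subforms B
       | _ => []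
       end.

Lemma subforms_self A : In A (subforms A).
Proof. destruct A; simpl; auto. Qed.

Lemma sub_closed_cons A l : sub_closed l ->
  match A with
  | And B D | Or B D | Imp B D => In B l /\ In D l
  | Box B => In B l
  | _ => True
  end -> sub_closed (A :: l).
Proof.
  intros Hl HA C [<-|HC]; [destruct A|specialize (Hl C HC); destruct C]; simpl; tauto.
Qed.

Lemma sub_closed_app l l' : sub_closed l -> sub_closed l' -> sub_closed (l ++ l').
Proof.
  intros H H' C HC; apply in_app_or in HC as [HC|HC];
    [specialize (H C HC)|specialize (H' C HC)]; destruct C; rewrite ?in_app_iff; tauto.
Qed.

Lemma subforms_closed A : sub_closed (subforms A).
Proof.
  induction A; simpl; apply sub_closed_cons; auto using sub_closed_app, subforms_self;
    try (intros C []); split; apply in_or_app; auto using subforms_self.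
Qed.

Theorem mainTheorem4 (A : form) :
  ~ derives iGLH A -> exists gamma : subst, ~ derives iGLHbox (app_subst gamma A).
Proof.
  intros HA; set (sub := subforms A); exists (unifier sub); intros H.
  (* [Pstar] is a theorem of iGLH, so it cannot imply [A] over iGL; some prime iGL-theory contains
     [Pstar] and omits [A]. *)
  assert (HP : ~ iGL (Imp (Pstar sub) A)).
  { intros HP; apply HA; eapply iGLH_mp; [apply iGLH_base, HP|apply iGLH_Pstar]. }
  apply HP, (prime_complete _ _ _ iGL_closed); intros w Hw HwP; apply NNPP; intros HwA.
  (* [Top] belongs to [Gamma_H] and to every prime theory, so any such [w] can start the
     induction. *)
  apply (Phi_refutes sub (subforms_closed A) (S (cnt (fun B => ~ w B) (boxes sub)))
           Top w A Gamma_H_Top Hw (prime_Top _ _ Hw) HwP); auto.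
  - apply subforms_self.
  - now apply entails_thm.
Qed.
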